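(* Let $g:\mathbb{N}\to\mathbb{R}$ be an essentially bounded real arithmetic function, and let $w'$ be the weight with $w'_H=C_H-u_H$ on $[-H,H]\cap\mathbb{Z}$, where $H=H(N)$ is a positive integer with $H\asymp N^{\vartheta}$ for a fixed $\vartheta\in(1/3,1)$. If there exists $G\in(0,1)$ such that $$J_{w',g}(N,h)\ll Nh^{2-G}\quad\text{for every integer } h\asymp N^{\theta}\ \text{with}\ \theta\in\Big(\frac{3\vartheta-1}{(1-G)\vartheta+G+1},\vartheta\Big],$$ then there exists $G'=G'(\vartheta,G)>0$ such that $J_{w',g\ast\mathbf{1}}(N,H)\ll NH^{2-3G'}$.
   Context: All asymptotic statements are as $N\to\infty$; $N,H$ are positive integers with $H=o(N)$; ''$x\sim N$'' means $x$ is an integer in $(N,2N]$; $A\asymp B$ means $B\ll A\ll B$. An arithmetic function $f$ is essentially bounded if $f(n)\ll_\varepsilon n^\varepsilon$ for every $\varepsilon>0$. The unit step function is $u(a)=1$ if $a>0$ and $u(a)=0$ otherwise; the Cesaro weight is $C_H(a)=\max(1-|a|/H,0)$. For a weight $w$ and a positive integer $h$, $w_h=w\cdot\mathbf{1}_{[-h,h]\cap\mathbb{Z}}$; for $w'$ one takes $w'_h(a)=C_h(a)-u(a)$ for integers $|a|\le h$ and $0$ otherwise. This weight has zero mass $\sum_a w'_h(a)=0$, so its weighted Selberg integral is $$J_{w',f}(N,h)=\sum_{x\sim N}\Big|\sum_n w'_h(n-x)f(n)\Big|^2.$$ $g\ast\mathbf{1}(n)=\sum_{d\mid n}g(d)$.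 *)

(* Defs.v *)
From HB Require Import structures.
From mathcomp Require Import all_boot all_order all_algebra.
From mathcomp Require Import all_classical all_reals all_analysis.

Set Implicit Arguments.
Unset Strict Implicit.
Unset Printing Implicit Defensive.

Import Order.TTheory GRing.Theory Num.Theory.
Import numFieldNormedType.Exports.

Local Open Scope classical_set_scope.
Local Open Scope ring_scope.

(* f << g as N tends to infinity; every implied constant depends on the two
   functions f and g as given, with all their parameters fixed. *)
Definition vinogradov (R : realType) (f g : nat -> R) : Prop :=
  (f : nat -> R^o) =O_\oo (g : nat -> R^o).

Definition asymp (R : realType) (f g : nat -> R) : Prop :=
  vinogradov g f /\ vinogradov f g.

Definition ess_bounded (R : realType) (f : nat -> R) : Prop :=
  forall e : R, 0 < e -> vinogradov f (fun n => n%:R `^ e).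

Definition unit_step (R : realType) (a : int) : R :=
  if 0 < a then 1 else 0.

Definition cesaro_weight (R : realType) (h : nat) (a : int) : R :=
  Num.max (1 - `|a%:~R| / h%:R) 0.

Definition restrict_weight (R : realType) (w : int -> R) (h : nat) (a : int) : R :=
  if `|a| <= h%:Z then w a else 0.

(* The triangle itself is rescaled with h: this is C_h - u, and not C_H - u,
   cut off at h. *)
Definition wprime (R : realType) (h : nat) : int -> R :=
  restrict_weight (fun a => cesaro_weight R h a - unit_step R a) h.

(* The argument w is the weight w_h already restricted to [-h, h], so that the
   sum over the positive integers n stops at x + h.  Arithmetic functions have
   domain nat, and their value at 0 is never used.  There is no main term to
   subtract: this is the Selberg integral only for a weight of zero mass. *)
Definition selberg (R : realType) (w : int -> R) (f : nat -> R) (N h : nat)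
    : R :=
  \sum_(N.+1 <= x < (2 * N).+1)
    `|\sum_(1 <= n < (x + h).+1) w (n%:Z - x%:Z) * f n| ^+ 2.

Definition Jwprime (R : realType) (f : nat -> R) (N h : nat) : R :=
  selberg (wprime R h) f N h.

(* The Dirichlet convolution of g with the constant function 1. *)
Definition dirichlet_one (R : realType) (g : nat -> R) (n : nat) : R :=
  \sum_(d <- divisors n) g d.

(* Main.v *)
Require Import Defs.
From mathcomp Require Import all_boot all_order all_algebra.
From mathcomp Require Import all_classical all_reals all_analysis.
From mathcomp Require Import complex ring lra zify.

(** Writing [u_h(x)] for the sum of [g] over [(x, x + h]], the weighted sum in
    the Selberg integral is the mean over [1 <= t <= h] of [u_h(x-t) - u_h(x)].
    Expanding the square of [u_h(x-t) - u_h(x)] shows conversely that a saving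
    in [J] gives a saving in the mean square of these differences, and this
    form of the hypothesis passes from a length [h/k] to the length [h] at the
    cost of a power of [k]; hence finitely many exponents theta give a bound
    uniform in [h].

    For [f = g * 1] the differences split over the divisors [d].  Those with
    [d > D] are regrouped by the cofactor [m], which turns them into the same
    problem for [g] at height [N/m] and length [H/m].  Those with [d <= D] are
    expanded in additive characters of denominator at most [D] and bounded by
    [(N + D^2) H] up to logarithms by the large sieve.  Taking [D] slightly
    below [(NH)^(1/2)] makes both parts small, and the exponents of [H/m] in
    base [N/m] then stay in the range of the hypothesis. *)

Set Implicit Arguments.
Unset Strict Implicit.
Unset Printing Implicit Defensive.

Import Order.TTheory GRing.Theory Num.Theory.
Import ComplexField.Normc.

Local Open Scope ring_scope.

(** * Window sums *)

(** Write v for [vartheta]. With D near (NH)^(1/2) the cofactors m run up to about N/D, that is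
    N^((1-v)/2), and there the exponent of H/m in base N/m falls to about (3v-1)/(1+v), which is
    positive since v > 1/3. The lower end of the range in the hypothesis has denominator (1-G)v + G
    + 1 = (1+v) + G(1-v), larger than 1+v, so it lies strictly below that exponent. All the room of
    the proof is in this gap.

    The hypothesis concerns one sequence of lengths at a time, with a constant depending on the
    sequence, whereas the lengths H/m have to be treated for all m at once; hence the need for
    uniformity in h. In [total_energy] the squares are taken before the mean over the shifts, so
    each difference can be split into differences of shorter windows and Cauchy's inequality applied
    to the pieces.

    Logarithms, implied constants and values of g are all absorbed by powers of T = N^tau, and [tau]
    is the final G'. *)

Lemma sum_nat_indicator (V : nmodType) (F : nat -> V) a b m K :
  (m <= a)%N -> (b <= K)%N ->
  \sum_(a <= n < b) F n = \sum_(m <= n < K) (if (a <= n < b)%N then F n else 0).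
Proof.
move=> ma bK; rewrite -big_mkcond /= (big_nat_widenl _ _ _ _ _ ma).
rewrite (big_nat_widen _ _ _ _ _ bK).
by apply: eq_bigl => n; rewrite /= andbC.
Qed.

Lemma count_nat_between (a b h : nat) :
  (\sum_(1 <= t < h.+1) ((a < t <= b) : nat) = minn b h - a)%N.
Proof.
elim: h => [|h IH]; first by rewrite big_geq // minn0 sub0n.
rewrite big_nat_recr //= IH; case: (boolP (a < h.+1 <= b)%N) => c; rewrite ?c; lia.
Qed.

Section Sums.
Variable R : realType.
Implicit Types (g : nat -> R).

(** Cauchy's inequality as nonnegativity of a variance: that of the ratios [z i / w i] about their
    mean, with weights [w i]. *)
Lemma sqr_sum_weighted (I : eqType) (r : seq I) (w z : I -> R) :
  (forall i, i \in r -> 0 < w i) ->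
  (\sum_(i <- r) z i) ^+ 2 <=
  (\sum_(i <- r) w i) * \sum_(i <- r) (z i ^+ 2 / w i).
Proof.
move=> w0; have [->|r0] := eqVneq r [::]; first by rewrite !big_nil expr0n mul0r.
set S := \sum_(i <- r) z i; set W := \sum_(i <- r) w i.
have W0 : 0 < W.
  case: r r0 w0 @S @W => // a r _ w0.
  rewrite /= big_cons ltr_pwDl ?w0 ?mem_head // big_seq sumr_ge0 // => i ir.
  by rewrite ltW // w0 // in_cons ir orbT.
have : 0 <= \sum_(i <- r) w i * (z i / w i - S / W) ^+ 2.
  by rewrite big_seq sumr_ge0 // => i ir; rewrite mulr_ge0 ?sqr_ge0 // ltW ?w0.
have -> : \sum_(i <- r) w i * (z i / w i - S / W) ^+ 2 =
          \sum_(i <- r) (z i ^+ 2 / w i) - S ^+ 2 / W.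
  transitivity (\sum_(i <- r) (z i ^+ 2 / w i - (2 * (S / W)) * z i
                               + (S / W) ^+ 2 * w i)).
    rewrite [LHS]big_seq [RHS]big_seq; apply: eq_bigr => i ir.
    have /gt_eqF/negbT := w0 _ ir; move: (w i) (z i) (S / W) => a b c a0.
    by field.
  rewrite big_split /= sumrB -!mulr_sumr -/S -/W.
  have W1 : W != 0 by rewrite gt_eqF.
  by field.
by rewrite subr_ge0 ler_pdivrMr // mulrC.
Qed.

Lemma sqr_sum_nat (z : nat -> R) m n :
  (\sum_(m <= i < n) z i) ^+ 2 <= (n - m)%:R * \sum_(m <= i < n) z i ^+ 2.
Proof.
have := @sqr_sum_weighted _ (index_iota m n) (fun=> 1) z (fun _ _ => ltr01).
rewrite big_const_seq count_predT size_iota iter_addr_0.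
by under [in X in _ <= _ * X]eq_bigr do rewrite divr1.
Qed.

Definition window g (h x : nat) : R := \sum_(x.+1 <= n < (x + h).+1) g n.

Lemma window_indicator g h x K : (x + h < K)%N ->
  window g h x = \sum_(1 <= n < K) (x < n <= x + h)%N%:R * g n.
Proof.
move=> xK; rewrite /window (@sum_nat_indicator _ _ _ _ 1 K) //.
by apply: eq_bigr => n _; rewrite ltnS; case: ifP; rewrite ?mul1r ?mul0r.
Qed.

(* Averaging the window over the shifts [1..h] gives the triangle C_h, the
   window itself is the step function. *)
Lemma wprime_sum g h x : (0 < h)%N -> (h <= x)%N ->
  h%:R * (\sum_(1 <= n < (x + h).+1) wprime R h (n%:Z - x%:Z) * g n) =
  \sum_(1 <= t < h.+1) (window g h (x - t) - window g h x).
Proof.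
move=> h0 hx; set K := (x + h).+1.
under [RHS]eq_big_nat => t /andP[t1 th].
  rewrite (@window_indicator g h (x - t) K); last by rewrite /K; lia.
  rewrite (@window_indicator g h x K); last by rewrite /K; lia.
  rewrite -sumrB; under eq_bigr => n _ do rewrite -mulrBl.
  over.
rewrite exchange_big /= mulr_sumr; apply: eq_big_nat => n /andP[n1 nK].
rewrite -mulr_suml mulrA; congr (_ * _).
rewrite sumrB big_const_nat iter_addr_0 subn1 /= -natr_sum.
have h0R : (h%:R : R) != 0 by rewrite pnatr_eq0 -lt0n.
have h0P : 0 < (h%:R : R) by rewrite ltr0n.
have xh : (x <= n + h -> x - n <= h)%N by lia.
rewrite /wprime /restrict_weight /cesaro_weight /unit_step.
(* In both cases h - |n - x| of the windows (x - t, x - t + h] contain n, which is h times the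
   triangle. For n > x the fixed window contains n as well and supplies the step function. *)
have [nx|xn] := leqP n x; last first.
  have -> : (\sum_(1 <= t < h.+1) ((x - t < n <= x - t + h)%N : nat) =
             x + h - n)%N.
    rewrite (eq_big_nat _ _ (F2 := fun t => (0 < t <= x + h - n)%N : nat)).
      by rewrite count_nat_between; rewrite /K in nK; lia.
    by move=> t /andP[t1 th]; congr nat_of_bool; rewrite /K in nK; lia.
  rewrite ifT; last by rewrite /K in nK; lia.
  rewrite ifT; last by lia.
  have -> : (n <= x + h)%N by rewrite /K in nK; lia.
  have -> : (n%:Z - x%:Z)%:~R = (n - x)%:R :> R by rewrite subzn ?(ltnW xn) // -pmulrn.
  rewrite normr_nat natrB; last by rewrite ltnW.
  rewrite natrB; last by rewrite /K in nK; lia.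
  rewrite natrD max_l.
    by rewrite /=; field.
  rewrite subr_ge0 ler_pdivrMr // mul1r lerBlDl -natrD ler_nat.
  by rewrite /K in nK; lia.
have -> : (\sum_(1 <= t < h.+1) ((x - t < n <= x - t + h)%N : nat) =
             h - (x - n))%N.
  rewrite (eq_big_nat _ _ (F2 := fun t => (x - n < t <= h)%N : nat)).
    by rewrite count_nat_between minnn.
  by move=> t /andP[t1 th]; congr nat_of_bool; lia.
rewrite /= mul0rn subr0.
rewrite (_ : (0 < n%:Z - x%:Z) = false); last by lia.
have e1 : `|(n%:Z - x%:Z)%:~R| = (x - n)%:R :> R.
  rewrite (_ : n%:Z - x%:Z = - (x - n)%N%:Z); last by lia.
  by rewrite rmorphN normrN normr_nat.
case: ifP => [c|c].
  have xnh : (x - n <= h)%N by lia.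
  rewrite e1 [(h - _)%:R]natrB // subr0 max_l; first by field.
  by rewrite subr_ge0 ler_pdivrMr // mul1r ler_nat.
by rewrite mulr0 (_ : (h - (x - n) = 0)%N) //; lia.
Qed.

End Sums.

(** * Mean squares of window differences *)

Section Energy.
Variable R : realType.
Implicit Types (g : nat -> R).

Definition shift_energy g N h t : R :=
  \sum_(N.+1 <= x < (2 * N).+1) (window g h (x - t) - window g h x) ^+ 2.

Definition total_energy g N h : R := \sum_(1 <= t < h.+1) shift_energy g N h t.

Lemma shift_energy_ge0 g N h t : 0 <= shift_energy g N h t.
Proof. by apply: sumr_ge0 => x _; rewrite sqr_ge0. Qed.

(** By [wprime_sum] the inner sum is a mean of h window differences, and Cauchy's inequality over
    the shifts applies. *)
Lemma Jwprime_le g N h : (0 < h)%N -> (h <= N)%N ->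
  h%:R * Jwprime g N h <= total_energy g N h.
Proof.
move=> h0 hN; rewrite /Jwprime /selberg /total_energy /shift_energy exchange_big /= mulr_sumr.
apply: ler_sum_nat => x /andP[Nx x2N].
have hR : 0 < (h%:R : R) by rewrite ltr0n.
rewrite real_normK ?num_real // -(ler_pM2l hR) mulrA -expr2 -exprMn.
rewrite wprime_sum //; last by lia.
by rewrite (le_trans (sqr_sum_nat _ _ _)) // subn1.
Qed.

Lemma ler_sum_const (F : nat -> R) a b c :
  (forall i, (a <= i < b)%N -> F i <= c) ->
  \sum_(a <= i < b) F i <= (b - a)%:R * c.
Proof.
move=> Fc; rewrite (le_trans (ler_sum_nat Fc)) //.
by rewrite big_const_nat iter_addr_0 mulr_natl.
Qed.

Section Bounded.
Variables (g : nat -> R) (B : R) (K : nat).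
Hypothesis gB : forall n, (0 < n <= K)%N -> `|g n| <= B.

Lemma window_bound h x : (x + h <= K)%N -> `|window g h x| <= h%:R * B.
Proof.
move=> xK; rewrite (le_trans (ler_norm_sum _ _ _)) //.
have -> : h%:R = ((x + h).+1 - x.+1)%:R :> R by congr _%:R; lia.
by apply: ler_sum_const => i ih; apply: gB; lia.
Qed.

Lemma windowS h x : window g h x + g (x + h).+1 = g x.+1 + window g h x.+1.
Proof.
rewrite /window -big_nat_recr; last by lia.
by rewrite big_ltn ?addSn //; lia.
Qed.

(** Each unit shift gains one value of [g] at one end of the window and loses one at the other. *)
Lemma window_step h x s : (s <= x)%N -> (x + h <= K)%N ->
  `|window g h (x - s) - window g h x| <= s%:R * (2 * B).
Proof.
elim: s => [|s IH] sx xK; first by rewrite subn0 subrr normr0 mul0r.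
rewrite -addn1 natrD mulrDl mul1r [leRHS]addrC.
have -> : window g h (x - (s + 1)) - window g h x =
  (window g h (x - s.+1) - window g h (x - s)) + (window g h (x - s) - window g h x).
  by rewrite addn1; ring.
rewrite (le_trans (ler_normD _ _)) // lerD ?IH //; last by lia.
have := windowS h (x - s.+1); rewrite -subSn // subSS => e.
have -> : window g h (x - s.+1) - window g h (x - s) =
  g (x - s)%N - g (x - s.+1 + h).+1 by move: e; lra.
rewrite (le_trans (ler_normB _ _)) // mulr_natl mulr2n lerD // gB //; lia.
Qed.

Lemma window_diff_sqr h s y : (y + h <= K)%N ->
  (window g h (y - s) - window g h y) ^+ 2 <= (2 * (h%:R * B)) ^+ 2.
Proof.
move=> yK; rewrite -[leLHS]real_normK ?num_real //.
rewrite lerXn2r ?nnegrE ?normr_ge0 //.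
  by rewrite mulr_ge0 // (le_trans (normr_ge0 _) (window_bound yK)).
rewrite (le_trans (ler_normB _ _)) // mulr_natl mulr2n lerD // window_bound //; lia.
Qed.

End Bounded.

Lemma window_sqr g B K h y : (forall n, (0 < n <= K)%N -> `|g n| <= B) ->
  (y + h <= K)%N -> window g h y ^+ 2 <= (h%:R * B) ^+ 2.
Proof.
move=> gB yK; rewrite -[leLHS]real_normK ?num_real //.
have wb := window_bound gB yK.
by rewrite lerXn2r ?nnegrE ?normr_ge0 // (le_trans (normr_ge0 _) wb).
Qed.

(** The shifted range leaves (N, 2N] in at most p points, each of size at most c; the points that it
    misses may be added because [Z] is nonnegative. *)
Lemma sum_shift_le (Z : nat -> R) (N p a b : nat) (c : R) :
  (forall y, 0 <= Z y) -> 0 <= c ->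
  (forall y, (N - p < y <= 2 * N + p)%N -> Z y <= c) ->
  (p <= N)%N -> (a <= p)%N -> (b <= p)%N ->
  \sum_(N.+1 <= x < (2 * N).+1) Z (x + a - b)%N <=
  \sum_(N.+1 <= x < (2 * N).+1) Z x + p%:R * c.
Proof.
move=> Z0 c0 Zc pN ap bp; have [ba|ab] := leqP b a.
  have -> : \sum_(N.+1 <= x < (2 * N).+1) Z (x + a - b)%N =
            \sum_(N.+1 + (a - b) <= y < (2 * N).+1 + (a - b)) Z y.
    rewrite big_addn addnK; apply: eq_big_nat => x _; congr Z; lia.
  have le1 : (N.+1 <= N.+1 + (a - b))%N by lia.
  have le2 : (N.+1 + (a - b) <= (2 * N).+1 + (a - b))%N by lia.
  have : \sum_(N.+1 + (a - b) <= y < (2 * N).+1 + (a - b)) Z y <=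
         \sum_(N.+1 <= y < (2 * N).+1 + (a - b)) Z y.
    by rewrite [leRHS](big_cat_nat le1 le2) /= lerDr sumr_ge0.
  move/le_trans; apply.
  rewrite [leLHS](@big_cat_nat _ _ _ (2 * N).+1) /=; try lia.
  rewrite lerD2l; apply: le_trans (@ler_sum_const _ _ _ c _) _.
    by move=> y yb; apply: Zc; lia.
  by rewrite ler_wpM2r // ler_nat; lia.
set e := (b - a)%N.
have -> : \sum_(N.+1 <= x < (2 * N).+1) Z (x + a - b)%N =
          \sum_(N.+1 - e <= y < (2 * N).+1 - e) Z y.
  rewrite -[N.+1 in LHS](@subnK e) ?big_addn; last by rewrite /e; lia.
  by apply: eq_big_nat => x _; congr Z; rewrite /e; lia.
have : \sum_(N.+1 - e <= y < (2 * N).+1 - e) Z y <=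
       \sum_(N.+1 - e <= y < (2 * N).+1) Z y.
  rewrite [leRHS](@big_cat_nat _ _ _ ((2 * N).+1 - e)) /= ?lerDl ?sumr_ge0 //;
  rewrite /e; lia.
move/le_trans; apply.
rewrite [leLHS](@big_cat_nat _ _ _ N.+1) /=; try by rewrite /e; lia.
rewrite addrC lerD2l; apply: le_trans (@ler_sum_const _ _ _ c _) _.
  by move=> y yb; apply: Zc; move: yb; rewrite /e; lia.
by rewrite ler_wpM2r // ler_nat; rewrite /e; lia.
Qed.

(* [(v - u)^2 = v^2 - u^2 - 2u(v - u)]: the first difference telescopes over x
   and leaves only edges, the second averages over t to the Selberg weight. *)
Lemma total_energy_le g B N h lam : (0 < h)%N -> (h <= N)%N -> 0 < lam ->
  (forall n, (0 < n <= 4 * N)%N -> `|g n| <= B) ->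
  total_energy g N h <= h%:R * (h%:R * (h%:R * B) ^+ 2 + lam * N%:R * (h%:R * B) ^+ 2
                        + Jwprime g N h / lam).
Proof.
move=> h0 hN lam0 gB.
have hR : 0 < (h%:R : R) by rewrite ltr0n.
pose A x := \sum_(1 <= n < (x + h).+1) wprime R h (n%:Z - x%:Z) * g n.
have -> : total_energy g N h =
  \sum_(1 <= t < h.+1) (\sum_(N.+1 <= x < (2 * N).+1) window g h (x - t) ^+ 2
                     - \sum_(N.+1 <= x < (2 * N).+1) window g h x ^+ 2)
  + h%:R * \sum_(N.+1 <= x < (2 * N).+1) (- 2 * window g h x * A x).
  rewrite mulr_sumr /total_energy.
  under [X in _ = _ + X]eq_big_nat => x /andP[Nx x2N].
    rewrite mulrCA wprime_sum //; last by lia.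
    rewrite mulr_sumr; over.
  rewrite [X in _ = _ + X]exchange_big /= -big_split /=; apply: eq_bigr => t _.
  by rewrite -sumrB -big_split /=; apply: eq_bigr => x _; ring.
rewrite -addrA mulrDr lerD //.
  apply: le_trans (@ler_sum_const _ _ _ (h%:R * (h%:R * B) ^+ 2) _) _.
    move=> t /andP[t1 th]; rewrite lerBlDl.
    have := @sum_shift_le (fun y => window g h y ^+ 2) N h 0 t ((h%:R * B) ^+ 2).
    under eq_bigr do rewrite addn0.
    apply=> //; [by move=> y; rewrite sqr_ge0|by rewrite sqr_ge0|move=> y yb].
    by apply: (@window_sqr g B (4 * N)) => //; lia.
  by rewrite subn1.
rewrite ler_pM2l // /Jwprime /selberg.
have -> : lam * N%:R * (h%:R * B) ^+ 2 =
          \sum_(N.+1 <= x < (2 * N).+1) lam * (h%:R * B) ^+ 2.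
  rewrite big_const_nat iter_addr_0 -mulr_natr subSS.
  have -> : (2 * N - N = N)%N by lia.
  by ring.
rewrite mulr_suml -big_split /=; apply: ler_sum_nat => x /andP[Nx x2N].
rewrite real_normK ?num_real // -/(A x).
have wb : window g h x ^+ 2 <= (h%:R * B) ^+ 2.
  by apply: (@window_sqr g B (4 * N)) => //; lia.
(* The cross term -2uA is split by the arithmetic-geometric mean inequality; [lam] stays free and is
   set to T^(-20) in [interp_bound]. *)
apply: (@le_trans _ _ (lam * window g h x ^+ 2 + A x ^+ 2 / lam)); last first.
  by rewrite lerD2r ler_pM2l.
rewrite -subr_ge0.
have -> : lam * window g h x ^+ 2 + A x ^+ 2 / lam - -2 * window g h x * A x =
          (lam * window g h x + A x) ^+ 2 / lam.
  by field; rewrite gt_eqF.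
by rewrite divr_ge0 ?sqr_ge0 // ltW.
Qed.

(** The fibres of t -> t/k have at most k elements; the last one may be cut short by h. *)
Lemma sum_divn_le (F : nat -> R) k h : (0 < k)%N -> (forall s, 0 <= F s) ->
  \sum_(0 <= t < h.+1) F (t %/ k)%N <=
  k%:R * \sum_(0 <= s < (h %/ k).+1) F s.
Proof.
move=> k0 F0.
have e n : \sum_(0 <= t < n * k) F (t %/ k)%N = k%:R * \sum_(0 <= s < n) F s.
  elim: n => [|n IH]; first by rewrite mul0n !big_geq // mulr0.
  rewrite big_nat_recr //= mulrDr -IH mulSn addnC.
  rewrite (@big_cat_nat _ _ _ (n * k)) //=; last by lia.
  congr (_ + _); rewrite -{1}[(n * k)%N]add0n big_addn addKn.
  rewrite (eq_big_nat _ _ (F2 := fun=> F n)); last first.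
    by move=> i /andP[_ ik]; rewrite addnC divnMDl // divn_small // addn0.
  by rewrite big_const_nat iter_addr_0 subn0 mulr_natl.
rewrite -e (@big_cat_nat _ _ _ h.+1 0 ((h %/ k).+1 * k)) //=.
  by rewrite lerDl sumr_ge0.
by rewrite ltn_ceil.
Qed.

Lemma windowD g a b x : window g (a + b) x = window g a x + window g b (x + a).
Proof.
by rewrite /window (@big_cat_nat _ _ _ (x + a).+1) ?addnA //; lia.
Qed.

Lemma windowM g k h x : window g (k * h) x = \sum_(0 <= i < k) window g h (x + i * h).
Proof.
elim: k => [|k IH]; first by rewrite mul0n /window !big_geq // addn0.
by rewrite big_nat_recr //= -IH mulSn addnC windowD.
Qed.

End Energy.

(** * From windows of length h/k to windows of length h *)

Section Interpolation.
Variable R : realType.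
Implicit Types (g : nat -> R).

Lemma sqrD_le (a b : R) : (a + b) ^+ 2 <= 2 * a ^+ 2 + 2 * b ^+ 2.
Proof. by have := sqr_ge0 (a - b); nra. Qed.

Lemma ler_sum_const0 (F : nat -> R) n c :
  (forall i, (0 <= i < n)%N -> F i <= c) -> \sum_(0 <= i < n) F i <= n%:R * c.
Proof. by move=> Fc; rewrite -[n in n%:R]subn0; apply: ler_sum_const. Qed.

Lemma ler_sqr_norm (a b : R) : `|a| <= b -> a ^+ 2 <= b ^+ 2.
Proof.
move=> ab; rewrite -[a ^+ 2]real_normK ?num_real //.
by rewrite lerXn2r ?nnegrE // (le_trans _ ab).
Qed.

(** The k steps of size t/k telescope to a shift by k(t/k); the fewer than k units left over cost 2B
    each by [window_step]. *)
Lemma window_shift_split g B K k h t x :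
  0 <= B -> (forall n, (0 < n <= K)%N -> `|g n| <= B) -> (0 < k)%N ->
  (t <= x)%N -> (x + h <= K)%N ->
  `|window g h (x - t) - window g h x -
    \sum_(0 <= j < k) (window g h (x - j * (t %/ k) - t %/ k) -
                       window g h (x - j * (t %/ k)))| <= k%:R * (2 * B).
Proof.
move=> B0 gB k0 tx xK; set s := (t %/ k)%N.
have ts : (t = k * s + t %% k)%N by rewrite mulnC -divn_eq.
have tk : (t %% k < k)%N by rewrite ltn_mod.
rewrite (eq_bigr (fun j => window g h (x - j.+1 * s) - window g h (x - j * s))).
  rewrite telescope_sumr // mul0n subn0.
  have -> : (x - t = x - k * s - t %% k)%N by lia.
  have -> : window g h (x - k * s - t %% k) - window g h x -
    (window g h (x - k * s) - window g h x) =
    window g h (x - k * s - t %% k) - window g h (x - k * s) by ring.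
  rewrite (le_trans (window_step gB _ _)) //; try lia.
  by rewrite ler_wpM2r ?ler_nat ?(ltnW tk) // mulr_ge0.
by move=> j _; rewrite mulSn addnC subnDA.
Qed.

(** Cutting the window into k pieces and the shift into k steps gives k^2 differences at length h/k.
    Cauchy's inequality costs k^2, the number of pieces another k^2. Each piece is a translate by at
    most h of the same energy, up to edges. *)
Lemma shift_energy_interp g B N k h t :
  (forall n, (0 < n <= 4 * N)%N -> `|g n| <= B) -> (0 < k)%N ->
  (0 < N)%N -> (h <= N)%N -> (t <= h)%N ->
  shift_energy g N h t <=
  2 * k%:R ^+ 4 * (shift_energy g N (h %/ k) (t %/ k)
                   + h%:R * (2 * ((h %/ k)%:R * B)) ^+ 2)
  + 32 * k%:R ^+ 4 * B ^+ 2 * N%:R.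
Proof.
move=> gB k0 N0 hN th; set h0 := (h %/ k)%N; set s := (t %/ k)%N.
have B0 : 0 <= B by rewrite (le_trans (normr_ge0 _) (gB 1%N _)) //; lia.
have kR : 1 <= (k%:R : R) by rewrite ler1n.
have hk : (h = k * h0 + h %% k)%N by rewrite mulnC -divn_eq.
have harmonic_sum : (h %% k < k)%N by rewrite ltn_mod.
have sk : (k * s <= t)%N by rewrite mulnC leq_trunc_div.
pose w i j x := window g h0 (x + i * h0 - j * s - s) - window g h0 (x + i * h0 - j * s).
have pt x : (N < x <= 2 * N)%N -> (window g h (x - t) - window g h x) ^+ 2 <=
    2 * k%:R ^+ 2 * (\sum_(0 <= i < k) \sum_(0 <= j < k) w i j x ^+ 2)
    + 32 * k%:R ^+ 4 * B ^+ 2.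
  move=> xN; set W := \sum_(0 <= i < k) \sum_(0 <= j < k) w i j x.
  (* The k pieces contribute 2kB each through [window_shift_split], and the two incomplete windows
     of length h mod k at most kB each. *)
  have e : `|window g h (x - t) - window g h x - W| <= 4 * k%:R ^+ 2 * B.
    have split y : window g h y =
        \sum_(0 <= i < k) window g h0 (y + i * h0) + window g (h %% k) (y + k * h0).
      by rewrite -windowM -windowD -hk.
    rewrite !split.
    set r1 := window g (h %% k) _; set r2 := window g (h %% k) _.
    have -> : \sum_(0 <= i < k) window g h0 (x - t + i * h0) + r1 -
      (\sum_(0 <= i < k) window g h0 (x + i * h0) + r2) - W =
      (\sum_(0 <= i < k) (window g h0 (x - t + i * h0) - window g h0 (x + i * h0) -
          \sum_(0 <= j < k) w i j x)) + r1 - r2.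
      by rewrite /W !sumrB; ring.
    have wb y : (y <= 3 * N)%N -> `|window g (h %% k) y| <= k%:R * B.
      move=> yN; rewrite (le_trans (window_bound gB _)) //; first by lia.
      by rewrite ler_wpM2r // ler_nat ltnW.
    have h1 : `|r1| <= k%:R * B by apply: wb; lia.
    have h2 : `|r2| <= k%:R * B by apply: wb; lia.
    have h3 : `|\sum_(0 <= i < k) (window g h0 (x - t + i * h0)
         - window g h0 (x + i * h0) - \sum_(0 <= j < k) w i j x)|
         <= k%:R * (k%:R * (2 * B)).
      rewrite (le_trans (ler_norm_sum _ _ _)) //.
      apply: ler_sum_const0 => i /andP[_ ik].
      have ih : (i * h0 + h0 <= h)%N by nia.
      rewrite (_ : (x - t + i * h0 = x + i * h0 - t)%N); last by lia.
      by apply: (@window_shift_split g B (4 * N)) => //; lia.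
    rewrite (le_trans (ler_normB _ _)) //.
    have kk : (k%:R : R) <= k%:R ^+ 2 by rewrite ler_eXnr.
    have := ler_normD (\sum_(0 <= i < k) (window g h0 (x - t + i * h0)
         - window g h0 (x + i * h0) - \sum_(0 <= j < k) w i j x)) r1.
    have : k%:R * B <= k%:R ^+ 2 * B by rewrite ler_wpM2r.
    by move: h1 h2 h3; nra.
  have -> : window g h (x - t) - window g h x =
            W + (window g h (x - t) - window g h x - W) by ring.
  rewrite (le_trans (sqrD_le _ _)) // lerD //.
    rewrite -mulrA ler_pM2l // (le_trans (sqr_sum_nat _ _ _)) // subn0.
    rewrite expr2 -mulrA ler_wpM2l // mulr_sumr ler_sum // => i _.
    by rewrite (le_trans (sqr_sum_nat _ _ _)) // subn0.
  have -> : 32 * k%:R ^+ 4 * B ^+ 2 = 2 * (4 * k%:R ^+ 2 * B) ^+ 2 by ring.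
  by rewrite ler_pM2l // ler_sqr_norm.
apply: (@le_trans _ _ (\sum_(N.+1 <= x < (2 * N).+1) (2 * k%:R ^+ 2 *
    (\sum_(0 <= i < k) \sum_(0 <= j < k) w i j x ^+ 2)
    + 32 * k%:R ^+ 4 * B ^+ 2))).
  by apply: ler_sum_nat => x xN; apply: pt; lia.
rewrite big_split /= big_const_nat iter_addr_0 subSS -[_ * B ^+ 2 *+ _]mulr_natr.
rewrite (_ : (2 * N - N)%N = N); last by lia.
rewrite lerD2r -mulr_sumr exchange_big /=.
under eq_bigr do rewrite exchange_big /=.
set Z := shift_energy g N h0 s + h%:R * (2 * (h0%:R * B)) ^+ 2.
have -> : 2 * k%:R ^+ 4 * Z = 2 * k%:R ^+ 2 * (k%:R * (k%:R * Z)) by ring.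
rewrite ler_pM2l; last by rewrite mulr_gt0 // exprn_gt0 // (lt_le_trans ltr01).
apply: ler_sum_const0 => i /andP[_ ik].
apply: ler_sum_const0 => j /andP[_ jk].
have ih : (i * h0 + h0 <= h)%N by nia.
have jh : (j * s + s <= h)%N by nia.
apply: (@sum_shift_le _ (fun y => (window g h0 (y - s) - window g h0 y) ^+ 2) N h
  (i * h0) (j * s)) => //; try lia; try by rewrite sqr_ge0.
  by move=> y; rewrite sqr_ge0.
by move=> y yN; apply: (@window_diff_sqr _ g B (4 * N)) => //; lia.
Qed.

(** Summing over t costs one further factor k, the size of the fibres of t -> t/k. *)
Lemma total_energy_interp g B N k h :
  (forall n, (0 < n <= 4 * N)%N -> `|g n| <= B) -> (0 < k)%N ->
  (0 < N)%N -> (h <= N)%N ->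
  total_energy g N h <=
  2 * k%:R ^+ 5 * total_energy g N (h %/ k)
  + h%:R * (8 * k%:R ^+ 4 * h%:R * ((h %/ k)%:R * B) ^+ 2
            + 32 * k%:R ^+ 4 * B ^+ 2 * N%:R).
Proof.
move=> gB k0 N0 hN; rewrite /total_energy.
set h0 := (h %/ k)%N.
apply: (@le_trans _ _ (\sum_(1 <= t < h.+1)
  (2 * k%:R ^+ 4 * shift_energy g N h0 (t %/ k) +
  (8 * k%:R ^+ 4 * h%:R * (h0%:R * B) ^+ 2 + 32 * k%:R ^+ 4 * B ^+ 2 * N%:R)))).
  apply: ler_sum_nat => t /andP[t1 th].
  by rewrite (le_trans (shift_energy_interp gB k0 N0 hN _)) // le_eqVlt; apply/orP; left;
    apply/eqP; ring.
rewrite big_split /= big_const_nat iter_addr_0 subn1 /= -[_ *+ h]mulr_natl lerD2r.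
rewrite -mulr_sumr -/(total_energy g N h0).
have -> : 2 * k%:R ^+ 5 * total_energy g N h0 = 2 * k%:R ^+ 4 * (k%:R * total_energy g N h0) by ring.
rewrite ler_wpM2l ?mulr_ge0 ?exprn_ge0 // /total_energy.
(* The shifts t < k fall into the fibre over 0, which is absent from [total_energy] but contributes
   nothing. *)
have s0 : shift_energy g N h0 0 = 0.
  by rewrite /shift_energy big1 // => x _; rewrite subn0 subrr expr0n.
have -> : \sum_(1 <= i < h0.+1) shift_energy g N h0 i = \sum_(0 <= i < h0.+1) shift_energy g N h0 i.
  by rewrite [RHS]big_ltn // s0 add0r.
rewrite (le_trans _ (sum_divn_le h k0 (shift_energy_ge0 g N h0))) //.
by rewrite [leRHS]big_ltn // div0n s0 add0r.
Qed.

End Interpolation.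

(** * The large sieve *)

(** A character evaluated at i + j factors, so after opening the squares the sum over i and j of
    each term is the square of one geometric sum. *)
Lemma bilinear_sieve (C : numClosedFieldType) (I : finType) (P : pred I)
    (z w : I -> C) L :
  \sum_(i < L) \sum_(j < L) `|\sum_(r | P r) z r * w r ^+ (i + j)| ^+ 2 <=
  \sum_(r | P r) \sum_(s | P s)
     `|z r| * `|z s| * `|\sum_(i < L) (w r * (w s)^*) ^+ i| ^+ 2.
Proof.
set LHS := (X in X <= _).
have LHS0 : 0 <= LHS.
  by do 2!(apply: sumr_ge0 => ? _); rewrite exprn_ge0.
rewrite -(ger0_norm LHS0).
have -> : LHS
  = \sum_(r | P r) \sum_(s | P s)
     z r * (z s)^* * (\sum_(i < L) (w r * (w s)^*) ^+ i) ^+ 2.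
  rewrite /LHS; transitivity (\sum_(i < L) \sum_(j < L) \sum_(r | P r)
      \sum_(s | P s) z r * w r ^+ (i + j) * (z s * w s ^+ (i + j))^*).
    apply: eq_bigr => i _; apply: eq_bigr => j _.
    by rewrite normCK rmorph_sum /= big_distrlr.
  under eq_bigr => i _ do rewrite exchange_big /=.
  rewrite exchange_big /=; apply: eq_bigr => r _.
  under eq_bigr => i _ do rewrite exchange_big /=.
  rewrite exchange_big /=; apply: eq_bigr => s _.
  rewrite expr2 big_distrlr /= mulr_sumr; apply: eq_bigr => i _.
  rewrite mulr_sumr; apply: eq_bigr => j _.
  rewrite rmorphM rmorphXn /= -exprD exprMn; ring.
rewrite (le_trans (ler_norm_sum _ _ _)) // ler_sum // => r _.
rewrite (le_trans (ler_norm_sum _ _ _)) // ler_sum // => s _.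
by rewrite normrM normrX normrM norm_conjC.
Qed.

Section LargeSieve.
Variable R : realType.

Lemma normcX (x : R[i]) n : normc (x ^+ n) = normc x ^+ n.
Proof. by elim: n => [|n IH]; rewrite ?expr0 ?normc1 // !exprS normcM IH. Qed.

Lemma normc_sum (I : Type) (r : seq I) (P : pred I) (F : I -> R[i]) :
  normc (\sum_(i <- r | P i) F i) <= \sum_(i <- r | P i) normc (F i).
Proof.
elim/big_ind2: _ => [|a b c d ab cd|//]; first by rewrite normc0.
by rewrite (le_trans (le_normcD _ _)) // lerD.
Qed.

Lemma normc_ge0 (x : R[i]) : 0 <= normc x.
Proof. by case: x => a b; rewrite sqrtr_ge0. Qed.

Lemma normc_conjc (x : R[i]) : normc (x^*)%C = normc x.
Proof. by case: x => a b /=; rewrite sqrrN. Qed.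

Lemma normcB (x y : R[i]) : normc (x - y) = normc (y - x).
Proof. by rewrite -normcN opprB. Qed.

(* Duality: opening the square puts all the oscillation into geometric sums,
   and Schur's test replaces the form by its largest row. *)
Lemma schur_sieve (I : finType) (P : pred I) (z w : I -> R[i]) L (K : R) :
  (forall r, P r -> \sum_(s | P s) normc (\sum_(i < L) (w r * (w s)^*%C) ^+ i) ^+ 2 <= K) ->
  \sum_(i < L) \sum_(j < L) normc (\sum_(r | P r) z r * w r ^+ (i + j)) ^+ 2 <=
  K * \sum_(r | P r) normc (z r) ^+ 2.
Proof.
move=> rowK; set k := fun r s => normc (\sum_(i < L) (w r * (w s)^*%C) ^+ i) ^+ 2.
have ksym r s : k r s = k s r.
  rewrite /k -[in LHS]normc_conjc rmorph_sum; congr (normc _ ^+ 2).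
  by apply: eq_bigr => i _; rewrite rmorphXn rmorphM /= conjcK mulrC.
have : \sum_(i < L) \sum_(j < L) normc (\sum_(r | P r) z r * w r ^+ (i + j)) ^+ 2
   <= \sum_(r | P r) \sum_(s | P s) normc (z r) * normc (z s) * k r s.
  have := @bilinear_sieve R[i] I P z w L.
  rewrite -lecR !rmorph_sum /=.
  have -> : \sum_(i < L) \sum_(j < L) `|\sum_(r | P r) z r * w r ^+ (i + j)| ^+ 2 =
   \sum_(i < L) (\sum_(j < L) normc (\sum_(r | P r) z r * w r ^+ (i + j)) ^+ 2)%:C%C.
    by apply: eq_bigr => i _; rewrite rmorph_sum; apply: eq_bigr => j _; rewrite rmorphXn.
  move/le_trans; apply; rewrite le_eqVlt; apply/orP; left; apply/eqP.
  apply: eq_bigr => r _; rewrite rmorph_sum; apply: eq_bigr => s _.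
  by rewrite /k rmorphM rmorphXn rmorphM.
move/le_trans; apply.
apply: (@le_trans _ _ (\sum_(r | P r) \sum_(s | P s)
    (normc (z r) ^+ 2 * k r s / 2 + normc (z s) ^+ 2 * k s r / 2))).
  apply: ler_sum => r _; apply: ler_sum => s _; rewrite (ksym s r).
  have := sqr_ge0 (normc (z r) - normc (z s)).
  have : 0 <= k r s by rewrite exprn_ge0 ?normc_ge0.
  by nra.
under eq_bigr do rewrite big_split /=.
rewrite big_split /= [X in _ + X]exchange_big /= -big_split /= mulr_sumr.
apply: ler_sum => r Pr; rewrite -big_split /=.
rewrite (eq_bigr (fun s => normc (z r) ^+ 2 * k r s)); last by move=> s _; field.
by rewrite -mulr_sumr mulrC ler_wpM2r ?exprn_ge0 ?normc_ge0 // rowK.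
Qed.

Lemma normc_geometric (w : R[i]) L : normc w = 1 ->
  normc (\sum_(i < L) w ^+ i) <= L%:R.
Proof.
move=> w1; rewrite (le_trans (normc_sum _ _ _)) //.
rewrite (eq_bigr (fun=> 1)); last by move=> i _; rewrite normcX w1 expr1n.
by rewrite sumr_const card_ord.
Qed.

(** One factor takes the trivial bound L, the other the closed form of the geometric sum. The
    inverse first power of the distance to 1 then sums over spaced points to a logarithm. *)
Lemma normc_geometric_sqr (w : R[i]) L : normc w = 1 -> w != 1 ->
  normc (\sum_(i < L) w ^+ i) ^+ 2 <= L%:R * (2 / normc (w - 1)).
Proof.
move=> w1 wn1; have n0 : 0 < normc (w - 1).
  rewrite lt_neqAle normc_ge0 andbT eq_sym; apply/eqP => /eq0_normc/eqP.
  by rewrite subr_eq0 (negPf wn1).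
rewrite expr2 ler_pM ?normc_ge0 ?normc_geometric //.
rewrite ler_pdivlMr // -normcM mulrC -subrX1.
by rewrite (le_trans (le_normcD _ _)) // normcN normc1 normcX w1 expr1n.
Qed.

(** The additive character e(r) = exp(2 pi i r). *)
Definition expi (r : R) : R[i] := (cos (2 * pi * r) +i* sin (2 * pi * r))%C.

Lemma expiD r s : expi (r + s) = expi r * expi s.
Proof.
rewrite /expi mulrDr cosD sinD; apply/eqP; rewrite eq_complex /= eqxx.
by apply/eqP; ring.
Qed.

Lemma expi0 : expi 0 = 1.
Proof. by rewrite /expi mulr0 cos0 sin0. Qed.

Lemma expi1 : expi 1 = 1.
Proof.
have -> : expi 1 = (cos (pi *+ 2) +i* sin (pi *+ 2))%C.
  by rewrite /expi mulr1 mulr_natl.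
by rewrite cos2pi sin2pi.
Qed.

Lemma expiM r n : expi (r * n%:R) = expi r ^+ n.
Proof.
elim: n => [|n IH]; first by rewrite mulr0 expi0 expr0.
by rewrite exprSr -IH -expiD -natr1 mulrDr mulr1.
Qed.

Lemma normc_expi r : normc (expi r) = 1.
Proof. by rewrite /expi /= cos2Dsin2 sqrtr1. Qed.

Lemma conj_expi r : (expi r)^*%C = expi (- r).
Proof. by rewrite /expi mulrN cosN sinN. Qed.

(* A multiple k r of r lands in [1/4, 1/2], where expi is at distance >= 1 from
   1, and that distance grows at most linearly in k. *)
Lemma expi_dist_half r : 0 < r -> r <= 1 / 2 -> 2 * r <= normc (expi r - 1).
Proof.
move=> r0 r1; have r2 : 0 < 2 * r by lra.
set k := Num.truncn (1 / (2 * r)).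
have /andP[k1 k2] : k%:R <= 1 / (2 * r) < k.+1%:R.
  by apply: truncn_itv; rewrite divr_ge0 // ltW.
have k0 : (0 < k)%N by rewrite truncn_gt0 ler_pdivlMr // mul1r; lra.
have kR : 1 <= (k%:R : R) by rewrite ler1n.
move: k1 k2; rewrite ler_pdivlMr // ltr_pdivrMr // -natr1 => k1 k2.
have : 1 <= normc (expi (r * k%:R) - 1).
  have c0 : cos (2 * pi * (r * k%:R)) <= 0.
    rewrite (_ : 2 * pi * (r * k%:R) = pi * (2 * (r * k%:R) - 1 / 2) + pi / 2); last by field.
    rewrite cosDpihalf oppr_le0 sin_ge0_pi //.
    have pi0 := pi_gt0 R.
    have u1 : 2 * (r * k%:R) <= 1 by move: k1; lra.
    have u2 : 1 < 4 * (r * k%:R).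
      have : r <= r * k%:R by rewrite ler_peMr // ltW.
      by move: k2; lra.
    apply/andP; split; first by rewrite mulr_ge0 ?ltW //; lra.
    by rewrite ler_piMr ?ltW //; lra.
  rewrite /expi /=.
  set c := cos _ in c0 *; set s := sin _.
  have : 1 <= (c - 1) ^+ 2 + (s - 0) ^+ 2 by have := sqr_ge0 s; nra.
  by move=> h; rewrite -[leLHS]sqrtr1 ler_sqrt // (le_trans _ h).
move=> h; have : normc (expi (r * k%:R) - 1) <= k%:R * normc (expi r - 1).
  rewrite expiM subrX1 normcM mulrC ler_wpM2r ?normc_ge0 //.
  by rewrite normc_geometric // normc_expi.
by move: h k1 (normc_ge0 (expi r - 1)) => /le_trans h k1 n0 /h; nra.
Qed.

(** The distance from r to the nearest integer is min(r, 1 - r). Adding the two inverses avoids the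
    case distinction, and each can be summed over spaced points on its own. *)
Lemma expi_dist r : 0 < r -> r < 1 -> (normc (expi r - 1))^-1 <= r^-1 + (1 - r)^-1.
Proof.
move=> r0 r1; have r1' : 0 < 1 - r by lra.
have [h|h] := lerP r (1 / 2).
  have := expi_dist_half r0 h => d.
  have : (normc (expi r - 1))^-1 <= r^-1 by rewrite lef_pV2 ?posrE //; lra.
  by move/le_trans; apply; rewrite lerDl invr_ge0 ltW.
have d : 2 * (1 - r) <= normc (expi (1 - r) - 1) by apply: expi_dist_half; lra.
have e : normc (expi (1 - r) - 1) = normc (expi r - 1).
  have -> : expi (1 - r) - 1 = expi (- r) * (1 - expi r).
    by rewrite mulrBr mulr1 -expiD addNr expi0 expiD expi1 mul1r.
  by rewrite normcM normc_expi mul1r normcB.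
have : (normc (expi r - 1))^-1 <= (1 - r)^-1.
  by rewrite -e lef_pV2 ?posrE //; lra.
by move/le_trans; apply; rewrite lerDr invr_ge0 ltW.
Qed.

End LargeSieve.

(** * Harmonic sums and Farey fractions *)

Section Fractions.
Variable R : realType.

Definition harmonic_sum (n : nat) : R := \sum_(1 <= k < n.+1) k%:R^-1.

Lemma harmonic_sum_ge0 n : 0 <= harmonic_sum n.
Proof. by apply: sumr_ge0 => i _; rewrite invr_ge0. Qed.

Lemma harmonic_sum_le m n : (m <= n)%N -> harmonic_sum m <= harmonic_sum n.
Proof.
move=> mn; rewrite /harmonic_sum [leRHS](@big_cat_nat _ _ _ m.+1) //= lerDl.
by apply: sumr_ge0 => i _; rewrite invr_ge0.
Qed.

Lemma sum_at_most_one (I : finType) (P : pred I) (F : I -> R) c :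
  0 <= c -> (forall i j, P i -> P j -> i = j) -> (forall i, P i -> F i <= c) ->
  \sum_(i | P i) F i <= c.
Proof.
move=> c0 u Fc; case: (pickP P) => [i Pi|n]; last by rewrite big_pred0.
rewrite (bigD1 i) //= big_pred0 ?addr0 ?Fc // => j.
by apply/negP => /andP[Pj /eqP ji]; apply: ji; apply: u.
Qed.

(** The [m i] are distinct integers of [1, M], so the terms are dominated by distinct terms of the
    harmonic sum. *)
Lemma sum_inv_le_harmonic (I : finType) (P : pred I) (y : I -> R) (m : I -> nat) M :
  (forall i, P i -> (0 < m i <= M)%N) -> (forall i, P i -> (m i)%:R <= y i) ->
  (forall i j, P i -> P j -> m i = m j -> i = j) ->
  \sum_(i | P i) (y i)^-1 <= harmonic_sum M.
Proof.
move=> mM my mi.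
have mM' i : P i -> (m i < M.+1)%N by move/mM/andP => [].
rewrite (partition_big (fun i => inord (m i) : 'I_M.+1)
  (fun k : 'I_M.+1 => 0 < k)%N) /=; last first.
  by move=> i Pi; rewrite inordK ?mM' //; case/andP: (mM _ Pi).
have -> : harmonic_sum M = \sum_(k < M.+1 | (0 < k)%N) (k%:R : R)^-1.
  rewrite /harmonic_sum big_geq_mkord; exact: eq_bigl.
apply: ler_sum => k k0; apply: sum_at_most_one.
- by rewrite invr_ge0.
- move=> i j /andP[Pi /eqP ei] /andP[Pj /eqP ej]; apply: mi => //.
  by rewrite -(inordK (mM' _ Pi)) -(inordK (mM' _ Pj)) ei ej.
- move=> i /andP[Pi /eqP ei].
  have e : m i = k by rewrite -ei inordK ?mM'.
  rewrite lef_pV2 ?posrE ?ltr0n // -?e ?my //.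
  by rewrite (lt_le_trans _ (my _ Pi)) // ltr0n e.
Qed.

(** Points at mutual distance at least 1 have distinct integer parts. *)
Lemma spaced_sum (I : finType) (P : pred I) (y : I -> R) M :
  (forall i, P i -> 1 <= y i < M.+1%:R) ->
  (forall i j, P i -> P j -> i != j -> 1 <= `|y i - y j|) ->
  \sum_(i | P i) (y i)^-1 <= harmonic_sum M.
Proof.
move=> yM ysp; apply: (@sum_inv_le_harmonic _ _ _ (fun i => Num.truncn (y i))).
- move=> i /yM /andP[y1 yM1]; rewrite truncn_gt0 y1 /= -ltnS.
  by rewrite truncn_lt_nat // (le_trans ler01).
- by move=> i /yM /andP[y1 _]; rewrite truncn_le (le_trans ler01).
- move=> i j Pi Pj e; apply/eqP; apply: contraT => ij.
  have /andP[yi _] := yM _ Pi; have /andP[yj _] := yM _ Pj.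
  have := ysp _ _ Pi Pj ij.
  have /andP[a1 a2] := truncn_itv (le_trans ler01 yi).
  have /andP[b1 b2] := truncn_itv (le_trans ler01 yj).
  rewrite e in a1 a2; rewrite -natr1 in a2; rewrite -natr1 in b2.
  by rewrite leNgt ltr_norml; have -> : - 1 < y i - y j < 1 by apply/andP; split; lra.
Qed.

Lemma expi_neq1 (r : R) : 0 < r -> r < 1 -> expi r != 1.
Proof.
move=> r0 r1; apply/negP => /eqP e.
have [h|h] := lerP r (1 / 2).
  by have := expi_dist_half r0 h; rewrite e subrr normc0; lra.
have : 2 * (1 - r) <= normc (expi (1 - r) - 1) by apply: expi_dist_half; lra.
rewrite expiD expi1 mul1r -conj_expi e conjc1 subrr normc0; lra.
Qed.

Lemma expi_dist_abs (r : R) : r != 0 -> `|r| < 1 ->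
  expi r != 1 /\ (normc (expi r - 1))^-1 <= `|r|^-1 + (1 - `|r|)^-1.
Proof.
move=> r0 r1; have r0' : 0 < `|r| by rewrite normr_gt0.
have h1 := expi_neq1 r0' r1; have h2 := expi_dist r0' r1.
have [p|n] := lerP 0 r; first by rewrite ger0_norm // in h1 h2 *.
rewrite ltr0_norm // in h1 h2 *.
have e : expi r = (expi (- r))^*%C by rewrite conj_expi opprK.
split; first by rewrite e -(conjc1 R) (inj_eq (can_inj (@conjcK R))).
have -> : normc (expi r - 1) = normc (expi (- r) - 1).
  by rewrite e -[in LHS](conjc1 R) -rmorphB normc_conjc.
by [].
Qed.

Lemma expi_nat n : expi (n%:R : R) = 1.
Proof. by rewrite -[n%:R]mul1r expiM expi1 expr1n. Qed.

(** Orthogonality of the additive characters modulo d. *)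
Lemma sum_expi_dvdn d n : (0 < d)%N ->
  \sum_(j < d) expi (j%:R / d%:R : R) ^+ n = ((d %| n) * d)%:R.
Proof.
move=> d0; have dR : (d%:R : R) != 0 by rewrite pnatr_eq0 -lt0n.
set w := expi (n%:R / d%:R : R).
have -> : \sum_(j < d) expi (j%:R / d%:R : R) ^+ n = \sum_(j < d) w ^+ j.
  by apply: eq_bigr => j _; rewrite -!expiM; congr expi; field.
have wE : w = expi ((n %% d)%:R / d%:R).
  rewrite /w {1}(divn_eq n d) natrD natrM mulrDl expiD mulfK // expi_nat mul1r //.
have [dn|dn] := boolP (d %| n)%N.
  rewrite wE (eqP dn) mul0r expi0 mul1n.
  rewrite (eq_bigr (fun=> 1)); last by move=> j _; rewrite expr1n.
  by rewrite sumr_const card_ord.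
rewrite mul0n.
have w1 : w != 1.
  rewrite wE expi_neq1 //.
    by rewrite divr_gt0 ?ltr0n // lt0n.
  by rewrite ltr_pdivrMr ?ltr0n // mul1r ltr_nat ltn_mod.
have : (w - 1) * \sum_(j < d) w ^+ j = 0.
  by rewrite -subrX1 -expiM divfK // expi_nat subrr.
by move/eqP; rewrite mulf_eq0 subr_eq0 (negPf w1) => /eqP.
Qed.

Section Farey.
Variable D : nat.
Implicit Types p q r s : 'I_D.+1 * 'I_D.+1.

(** A pair is (denominator, numerator). The fraction 0 is left out: its character is constant and
    cancels in every difference of windows. *)
Definition frac p := (0 < p.2)%N && (p.2 < p.1)%N.
Definition farey p := frac p && coprime p.1 p.2.
Definition fval p : R := p.2%:R / p.1%:R.
Definition lowest p : 'I_D.+1 * 'I_D.+1 :=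
  let e := gcdn p.1 p.2 in (inord (p.1 %/ e), inord (p.2 %/ e)).

Lemma lowestE p : ((lowest p).1 = p.1 %/ gcdn p.1 p.2 :> nat)%N *
                  ((lowest p).2 = p.2 %/ gcdn p.1 p.2 :> nat)%N.
Proof.
by split; rewrite /= inordK // ltnS (leq_trans (leq_div _ _)) // -ltnS ltn_ord.
Qed.

Lemma frac_gcd p : frac p -> (0 < gcdn p.1 p.2)%N.
Proof. by case/andP=> p0 _; rewrite gcdn_gt0 p0 orbT. Qed.

Lemma lowestM p : (p.1 = (lowest p).1 * gcdn p.1 p.2 :> nat)%N *
                  (p.2 = (lowest p).2 * gcdn p.1 p.2 :> nat)%N.
Proof. by rewrite !lowestE !divnK ?dvdn_gcdl ?dvdn_gcdr. Qed.

Lemma farey_lowest p : frac p -> farey (lowest p).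
Proof.
move=> fp; have g0 := frac_gcd fp; have [e1 e2] := lowestM p.
rewrite /farey /frac.
case/andP: fp => p0 p1.
have -> : (0 < (lowest p).2)%N by move: p0; rewrite e2; case: ((lowest p).2 : nat).
have -> : ((lowest p).2 < (lowest p).1)%N.
  by move: p1; rewrite {1}e1 {1}e2 ltn_pmul2r.
rewrite /= /coprime; have : (gcdn (lowest p).1 (lowest p).2 * gcdn p.1 p.2 = gcdn p.1 p.2)%N.
  by rewrite muln_gcdl -e1 -e2.
by rewrite -{2}[gcdn p.1 p.2]mul1n => /eqP; rewrite eqn_pmul2r.
Qed.

Lemma fval_lowest p : frac p -> fval (lowest p) = fval p.
Proof.
move=> fp; have g0 := frac_gcd fp; have [e1 e2] := lowestM p.
have gR : ((gcdn p.1 p.2)%:R : R) != 0 by rewrite pnatr_eq0 -lt0n.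
rewrite /fval; move: gR e1 e2; move: (lowest p) (gcdn _ _) => q e eR -> ->.
by rewrite !natrM -mulf_div divff ?mulr1.
Qed.

Lemma frac_gt0 p : frac p -> 0 < (p.1%:R : R).
Proof. by case/andP => a b; rewrite ltr0n (leq_trans _ b). Qed.

Lemma fval_itv p : frac p -> 0 < fval p < 1.
Proof.
move=> fp; have p1 := frac_gt0 fp; case/andP: fp => a b.
rewrite /fval; apply/andP; split; first by rewrite divr_gt0 ?ltr0n // (leq_trans _ b).
by rewrite ltr_pdivrMr // mul1r ltr_nat.
Qed.

(** The numerator c b - a e of the difference is a positive integer, and its denominator is at most
    D^2. *)
Lemma natr_gap (a b c e : nat) : (0 < b)%N -> (0 < e)%N ->
  (b * e <= D ^ 2)%N -> (a%:R / b%:R : R) < c%:R / e%:R ->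
  1 <= (D ^ 2)%:R * (c%:R / e%:R - a%:R / b%:R : R).
Proof.
move=> b0 e0 bD lt.
have bR : 0 < (b%:R : R) by rewrite ltr0n.
have eR : 0 < (e%:R : R) by rewrite ltr0n.
have : (a * e < c * b)%N.
  rewrite -(ltr_nat R) !natrM -ltr_pdivrMr // mulrAC -ltr_pdivlMr //.
move=> acbe; have h : a%:R * e%:R + 1 <= c%:R * b%:R :> R.
  by rewrite -!natrM natr1 ler_nat.
have -> : c%:R / e%:R - a%:R / b%:R = (c%:R * b%:R - a%:R * e%:R) / (b%:R * e%:R) :> R.
  by field; rewrite !gt_eqF.
rewrite mulrA ler_pdivlMr ?mulr_gt0 // mul1r.
have : (b%:R * e%:R : R) <= (D ^ 2)%:R by rewrite -natrM ler_nat.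
have : 1 <= c%:R * b%:R - a%:R * e%:R :> R by lra.
by move=> h1 h2; rewrite (le_trans h2) // ler_peMr.
Qed.

Lemma farey_den p q : frac p -> frac q ->
  [/\ (0 < p.1)%N, (0 < q.1)%N & (p.1 * q.1 <= D ^ 2)%N].
Proof.
move=> fp fq; split; rewrite -?(ltr0n R) ?frac_gt0 //.
by rewrite expnS expn1 leq_mul // -ltnS ltn_ord.
Qed.

Lemma farey_spaced p q : farey p -> farey q -> p != q ->
  1 <= (D ^ 2)%:R * `|fval p - fval q|.
Proof.
move=> /andP[fp cp] /andP[fq cq] pq; have [p0 q0 pD] := farey_den fp fq.
have [h|h|h] := ltgtP (fval p) (fval q).
- by rewrite distrC gtr0_norm ?subr_gt0 // natr_gap.
- by rewrite gtr0_norm ?subr_gt0 // natr_gap // mulnC.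
case/negP: pq; move: h => /eqP.
rewrite /fval eqr_div ?pnatr_eq0 -?lt0n // -!natrM eqr_nat => /eqP e.
(* By Gauss's lemma the denominators of two equal reduced fractions divide each other. *)
have d1 : (p.1 %| q.1)%N by rewrite -(Gauss_dvdr _ cp) e dvdn_mull.
have d2 : (q.1 %| p.1)%N by rewrite -(Gauss_dvdr _ cq) -e dvdn_mull.
have e1 : (p.1 = q.1 :> nat)%N by apply/eqP; rewrite eqn_dvd d1.
move: e; rewrite e1 => /eqP; rewrite eqn_pmul2r // => /eqP e2.
by apply/eqP; case: p q e1 e2 {fp cp fq cq p0 q0 pD d1 d2} => [a b] [c d] /= e1 e2;
  congr (_, _); apply/val_inj.
Qed.

(** This is the distance the other way round the circle: it separates the smaller fraction plus 1,
    of the same denominator, from the larger one. *)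
Lemma farey_gap p q : frac p -> frac q ->
  1 <= (D ^ 2)%:R * (1 - `|fval p - fval q|).
Proof.
wlog h : p q / fval q <= fval p.
  move=> W fp fq; have [h|h] := leP (fval q) (fval p); first exact: (W p q h fp fq).
  by rewrite distrC; apply: (W q p (ltW h)).
move=> fp fq; have [p0 q0 pD] := farey_den fp fq.
rewrite ger0_norm ?subr_ge0 //.
have /andP[_ p1] := fval_itv fp; have /andP[q1 _] := fval_itv fq.
have -> : 1 - (fval p - fval q) = (q.2 + q.1)%:R / q.1%:R - p.2%:R / p.1%:R.
  by rewrite natrD mulrDl divff ?pnatr_eq0 -?lt0n // /fval; ring.
apply: natr_gap => //; rewrite natrD mulrDl divff ?pnatr_eq0 -?lt0n //.
by rewrite -/(fval p) -/(fval q); lra.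
Qed.

End Farey.
End Fractions.

(** * The divisors up to D *)

Section SmallDivisors.
Variables (R : realType) (D : nat).
Implicit Types p q r s : 'I_D.+1 * 'I_D.+1.
Local Notation T := ('I_D.+1 * 'I_D.+1)%type.
Local Notation fv := (@fval R D).

(** The last hypothesis holds for points on one side of r, whose distances to r are spaced like the
    points themselves; two points on opposite sides could be equidistant from r. *)
Lemma farey_sum_inv (P : pred T) r :
  frac r -> (forall s, P s -> farey s && (s != r)) -> farey r ->
  (forall s s', P s -> P s' ->
     `|(`|fv r - fv s| - `|fv r - fv s'|)| = `|fv s - fv s'|) ->
  \sum_(s | P s) (((D ^ 2)%:R * `|fv r - fv s|)^-1
                + ((D ^ 2)%:R * (1 - `|fv r - fv s|))^-1) <= 2 * harmonic_sum R (D ^ 2).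
Proof.
move=> fr Pf Fr Pd; rewrite big_split /= mulr_natl mulr2n.
have frs s : P s -> frac s by move/Pf/andP => [/andP[]].
have D0 : 0 <= ((D ^ 2)%:R : R) by [].
have b1 s : P s -> 1 <= (D ^ 2)%:R * `|fv r - fv s|.
  by move=> /Pf /andP[Fs sr]; apply: farey_spaced; rewrite // eq_sym.
have b2 s : P s -> 1 <= (D ^ 2)%:R * (1 - `|fv r - fv s|).
  by move=> /frs fs; apply: farey_gap.
apply: lerD; apply: spaced_sum.
- by move=> s Ps; rewrite b1 //= -natr1; have := b2 _ Ps; lra.
- move=> s s' Ps Ps' ss; rewrite -mulrBr normrM ger0_norm // Pd //.
  by apply: farey_spaced => //; [move: (Pf _ Ps)|move: (Pf _ Ps')] => /andP[].
- by move=> s Ps; rewrite b2 //= -natr1; have := b1 _ Ps; lra.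
- move=> s s' Ps Ps' ss; rewrite -mulrBr normrM ger0_norm //.
  have -> : 1 - `|fv r - fv s| - (1 - `|fv r - fv s'|) =
    - (`|fv r - fv s| - `|fv r - fv s'|) by ring.
  rewrite normrN Pd //.
  by apply: farey_spaced => //; [move: (Pf _ Ps)|move: (Pf _ Ps')] => /andP[].
Qed.

(** The diagonal term gives L^2. The others are split by their side of r; each side contributes two
    harmonic sums, one for each way round the circle, with the factor 2 L D^2. *)
Lemma farey_row r L : farey r ->
  \sum_(s | farey s) normc (\sum_(i < L) (expi (fv r) * (expi (fv s))^*%C) ^+ i) ^+ 2
  <= L%:R ^+ 2 + 8 * L%:R * (D ^ 2)%:R * harmonic_sum R (D ^ 2).
Proof.
move=> Fr; have fr : frac r by case/andP: Fr.
rewrite (bigD1 r) // lerD //.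
  rewrite conj_expi -expiD subrr expi0; apply: lerXn2r; rewrite ?nnegrE ?normc_ge0 //.
  by apply: normc_geometric; rewrite normc1.
pose G s : R := ((D ^ 2)%:R * `|fv r - fv s|)^-1
                + ((D ^ 2)%:R * (1 - `|fv r - fv s|))^-1.
have P1 : \sum_(s | (farey s && (s != r)) && (fv s < fv r)) G s <= 2 * harmonic_sum R (D ^ 2).
  apply: farey_sum_inv => // [s /andP[]//|s s' /andP[_ h] /andP[_ h']].
  rewrite [X in X - _]gtr0_norm ?[X in _ - X]gtr0_norm ?subr_gt0 //.
  by rewrite -[RHS]normrN; congr (`|_|); ring.
have P2 : \sum_(s | (farey s && (s != r)) && ~~ (fv s < fv r)) G s <= 2 * harmonic_sum R (D ^ 2).
  apply: farey_sum_inv => // [s /andP[]//|s s' /andP[_ h] /andP[_ h']].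
  rewrite -!leNgt in h h'; rewrite [X in X - _]ler0_norm ?[X in _ - X]ler0_norm ?subr_le0 //.
  by congr (`|_|); ring.
have -> : 8 * L%:R * (D ^ 2)%:R * harmonic_sum R (D ^ 2) =
  (2 * L%:R * (D ^ 2)%:R) * (2 * harmonic_sum R (D ^ 2) + 2 * harmonic_sum R (D ^ 2)) by ring.
have c0 : 0 <= 2 * L%:R * ((D ^ 2)%:R : R) by rewrite !mulr_ge0.
apply: le_trans (ler_wpM2l c0 (lerD P1 P2)).
rewrite -(bigID (fun s => fv s < fv r)) mulr_sumr.
apply: ler_sum => s /andP[Fs sr]; have fs : frac s by case/andP: Fs.
have sp : 1 <= (D ^ 2)%:R * `|fv r - fv s|.
  by apply: farey_spaced; rewrite // eq_sym.
have gp : 1 <= (D ^ 2)%:R * (1 - `|fv r - fv s|) by apply: farey_gap.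
have D0 : 0 < ((D ^ 2)%:R : R).
  rewrite lt_neqAle ler0n andbT eq_sym; apply/eqP => e.
  by move: sp; rewrite e mul0r; lra.
have a0 : 0 < `|fv r - fv s| by rewrite -(pmulr_rgt0 _ D0); lra.
have a1 : 0 < 1 - `|fv r - fv s| by rewrite -(pmulr_rgt0 _ D0); lra.
rewrite conj_expi -expiD.
have [w1 wd] := @expi_dist_abs R (fv r - fv s) ltac:(by rewrite -normr_gt0) ltac:(lra).
rewrite (le_trans (normc_geometric_sqr _ (normc_expi _) w1)) //.
have -> : 2 * L%:R * (D ^ 2)%:R * G s =
  L%:R * (2 * (`|fv r - fv s|^-1 + (1 - `|fv r - fv s|)^-1)).
  move/gt_eqF/negbT: a0; move/gt_eqF/negbT: a1; move/gt_eqF/negbT: D0; rewrite /G.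
  move: (1 - `|fv r - fv s|) `|fv r - fv s| ((D ^ 2)%:R : R) => v u c c1 v1 u1.
  by field; rewrite c1 u1 v1.
by rewrite ler_wpM2l // ler_pM2l.
Qed.

Variables (g : nat -> R) (B : R).
Hypothesis gB : forall d, (0 < d <= D)%N -> `|g d| <= B.
Hypothesis B0 : 0 <= B.

Definition divisor_sum n : R := \sum_(1 <= d < D.+1) (d %| n)%:R * g d.

(** The truncated Ramanujan coefficient: for reduced q, the sum of g(d)/d over the d <= D divisible
    by the denominator of q, each such d carrying exactly one fraction that reduces to q. *)
Definition farey_coef q : R[i] :=
  \sum_(p | frac p && (lowest p == q)) (g p.1 / p.1%:R)%:C%C.

(** The multiplier with which the difference of the windows at y and y + t acts on the character n
    -> w^n, apart from the factor w^y. *)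
Definition shift_symbol (H t : nat) (w : R[i]) : R[i] :=
  (1 - w ^+ t) * w * \sum_(i < H) w ^+ i.

(** The indicator of d | n is the mean of the d characters modulo d; the trivial ones are set apart
    because they do not depend on n. *)
Lemma divisor_sumE n : (divisor_sum n)%:C%C =
  \sum_(d : 'I_D.+1 | (0 < d)%N) (g d / d%:R)%:C%C +
  \sum_(p | frac p) (g p.1 / p.1%:R)%:C%C * expi (fv p) ^+ n.
Proof.
have -> : \sum_(p | frac p) (g p.1 / p.1%:R)%:C%C * expi (fv p) ^+ n =
  \sum_(d : 'I_D.+1 | (0 < d)%N) \sum_(j : 'I_D.+1 | (0 < j < d)%N)
     (g d / d%:R)%:C%C * expi (j%:R / d%:R) ^+ n.
  rewrite pair_big_dep /=; apply: eq_bigl => p; rewrite /frac.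
  by apply/idP/idP => /andP[a b]; rewrite ?b ?a ?andbT ?(leq_trans _ b) //; case/andP: b => -> ->.
rewrite -big_split /= /divisor_sum big_geq_mkord rmorph_sum /=.
apply: eq_big => // d d0.
have dR : (d%:R : R) != 0 by rewrite pnatr_eq0 -lt0n.
transitivity ((g d / d%:R)%:C%C * \sum_(j < d) expi (j%:R / d%:R : R) ^+ n).
  rewrite sum_expi_dvdn // natrM -[X in _ * (_ * X)](rmorph_nat (real_complex R)).
  rewrite -[X in _ * (X * _)](rmorph_nat (real_complex R)) -!rmorphM /=.
  by congr (_%:C)%C; field.
rewrite -mulr_sumr -[X in _ = X + _]mulr1 -mulrDr; congr (_ * _).
rewrite (big_ord_widen D.+1 (fun j => expi (j%:R / d%:R : R) ^+ n)); last first.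
  by rewrite ltnW // ltn_ord.
rewrite (bigD1 ord0) //= mul0r expi0 expr1n; congr (_ + _).
by apply: eq_bigl => j; rewrite andbC lt0n.
Qed.

(** The trivial characters contribute equally to all windows of length H and cancel. The others are
    grouped by reduced fraction, since the large sieve requires distinct frequencies. *)
Lemma window_divisor_sumE H t y :
  (window divisor_sum H y - window divisor_sum H (y + t))%:C%C =
  \sum_(q | farey q) farey_coef q * shift_symbol H t (expi (fv q)) * expi (fv q) ^+ y.
Proof.
have -> : \sum_(q | farey q) farey_coef q * shift_symbol H t (expi (fv q)) * expi (fv q) ^+ y
  = \sum_(p | frac p) (g p.1 / p.1%:R)%:C%C *
      (shift_symbol H t (expi (fv p)) * expi (fv p) ^+ y).
  rewrite [RHS](partition_big (@lowest D) (@farey D)); last by move=> p; exact: farey_lowest.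
  apply: eq_bigr => q Fq; rewrite /farey_coef -mulrA mulr_suml.
  by apply: eq_bigr => p /andP[fp /eqP <-]; rewrite fval_lowest.
have wE x : (window divisor_sum H x)%:C%C =
  H%:R * (\sum_(d : 'I_D.+1 | (0 < d)%N) (g d / d%:R)%:C%C) +
  \sum_(p | frac p) (g p.1 / p.1%:R)%:C%C *
     (expi (fv p) ^+ x * (expi (fv p) * \sum_(i < H) expi (fv p) ^+ i)).
  rewrite /window rmorph_sum /=; under eq_bigr do rewrite divisor_sumE.
  rewrite big_split /= big_const_nat iter_addr_0 subSS addKn -[_ *+ H]mulr_natl.
  congr (_ + _); rewrite exchange_big /=; apply: eq_bigr => p fp.
  rewrite -mulr_sumr; congr (_ * _).
  rewrite -{1}[x.+1]add0n big_addn subSS addKn big_mkord !mulr_sumr.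
  by apply: eq_bigr => i _; rewrite addnS exprS exprD; ring.
rewrite rmorphB /= !wE opprD addrACA subrr add0r -sumrB; apply: eq_bigr => p fp.
by rewrite /shift_symbol exprD; ring.
Qed.

Lemma normc_real (x : R) : normc (x%:C)%C = `|x|.
Proof. by rewrite /= expr0n addr0 sqrtr_sqr. Qed.

(** The fractions reducing to q have denominators e [q.1] with distinct e <= D, and the sum of the
    1/e is harmonic. *)
Lemma farey_coef_le q : frac q -> normc (farey_coef q) <= B * harmonic_sum R D / q.1%:R.
Proof.
move=> fq; have q0 := frac_gt0 R fq.
rewrite /farey_coef (le_trans (normc_sum _ _ _)) //.
apply: (@le_trans _ _ (\sum_(p | frac p && (lowest p == q))
   B / q.1%:R * ((gcdn p.1 p.2)%:R)^-1)).
  apply: ler_sum => p /andP[fp /eqP e].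
  have p0 := frac_gt0 R fp; have [e1 _] := lowestM p.
  rewrite normc_real normrM [X in _ * X]ger0_norm ?invr_ge0 ?(ltW p0) //.
  have -> : B / q.1%:R / (gcdn p.1 p.2)%:R = B / p.1%:R.
    by rewrite -e [in RHS]e1 natrM invfM mulrA.
  rewrite ler_wpM2r ?invr_ge0 ?(ltW p0) // gB //.
  by rewrite -(ltr0n R) p0 -ltnS ltn_ord.
rewrite -mulr_sumr [leRHS]mulrAC ler_wpM2l ?divr_ge0 ?(ltW q0) //.
apply: (@sum_inv_le_harmonic _ _ _ _ (fun p => gcdn p.1 p.2)) => [p|//|p p'].
  move=> /andP[fp _]; rewrite frac_gcd //=.
  case/andP: fp => a b; rewrite (leq_trans (dvdn_leq a (dvdn_gcdr _ _))) //.
  by rewrite -ltnS ltn_ord.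
move=> /andP[fp /eqP e] /andP[fp' /eqP e'] ee.
have [a1 a2] := lowestM p; have [b1 b2] := lowestM p'.
rewrite e ee in a1 a2; rewrite e' in b1 b2.
have c1 : p.1 = p'.1 by apply: val_inj; rewrite /= a1.
have c2 : p.2 = p'.2 by apply: val_inj; rewrite /= a2.
by rewrite (surjective_pairing p) c1 c2 -surjective_pairing.
Qed.

Lemma normc_shift_symbol H t (w : R[i]) : normc w = 1 -> w != 1 ->
  normc (shift_symbol H t w) ^+ 2 <= 8 * H%:R / normc (w - 1).
Proof.
move=> w1 wn1; rewrite /shift_symbol !normcM w1 mulr1 exprMn.
have h1 : normc (1 - w ^+ t) ^+ 2 <= 2 ^+ 2.
  rewrite lerXn2r ?nnegrE ?normc_ge0 //.
  by rewrite (le_trans (le_normcD _ _)) // normcN normc1 normcX w1 expr1n.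
have := ler_pM (exprn_ge0 _ (normc_ge0 _)) (exprn_ge0 _ (normc_ge0 _)) h1
  (normc_geometric_sqr H w1 wn1).
by move/le_trans; apply; rewrite le_eqVlt; apply/orP; left; apply/eqP; ring.
Qed.

(** For a fraction j/d the squared coefficient is of size d^(-2) and the squared symbol of size H
    (d/j + d/(d - j)), up to B and logarithms. Two harmonic sums come from the coefficients and two
    from summing over d and j; only one power of H remains. *)
Lemma farey_coef_sum H t :
  \sum_(q | farey q) normc (farey_coef q * shift_symbol H t (expi (fv q))) ^+ 2 <=
  16 * H%:R * B ^+ 2 * harmonic_sum R D ^+ 4.
Proof.
have h0 := harmonic_sum_ge0 R D.
apply: (@le_trans _ _ (\sum_(q : T | frac q) 8 * H%:R * B ^+ 2 * harmonic_sum R D ^+ 2 *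
   (q.1%:R^-1 * (q.2%:R^-1 + ((q.1 - q.2)%N%:R)^-1)))).
  rewrite [leRHS](bigID (fun q => coprime q.1 q.2)) /=.
  rewrite -[leLHS]addr0 lerD //; last first.
    by apply: sumr_ge0 => q _; rewrite !mulr_ge0 ?exprn_ge0 ?invr_ge0 ?addr_ge0 ?invr_ge0.
  apply: ler_sum => q Fq; have fq : frac q by case/andP: Fq.
  have q0 := frac_gt0 R fq; have /andP[b0 b1] := fval_itv R fq.
  have [q2 q21] : (0 < (q.2%:R : R)) /\ (q.2%:R < q.1%:R :> R).
    by case/andP: fq => u v; rewrite ltr0n ltr_nat.
  have w1 := expi_neq1 b0 b1; have wd := expi_dist b0 b1.
  rewrite normcM exprMn.
  have c2 : normc (farey_coef q) ^+ 2 <= (B * harmonic_sum R D / q.1%:R) ^+ 2.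
    rewrite lerXn2r ?nnegrE ?normc_ge0 ?farey_coef_le //.
    by rewrite !mulr_ge0 // invr_ge0 ltW.
  have s2 := normc_shift_symbol H t (normc_expi _) w1.
  have s3 : 8 * H%:R / normc (expi (fv q) - 1) <= 8 * H%:R * ((fv q)^-1 + (1 - fv q)^-1).
    by rewrite ler_wpM2l // mulr_ge0.
  have := ler_pM (exprn_ge0 _ (normc_ge0 _)) (exprn_ge0 _ (normc_ge0 _)) c2
    (le_trans s2 s3).
  move/le_trans; apply; rewrite le_eqVlt; apply/orP; left; apply/eqP.
  rewrite /fval natrB; last by rewrite -(ler_nat R) ltW.
  by field; rewrite !gt_eqF ?subr_gt0.
rewrite -mulr_sumr.
have -> : 16 * H%:R * B ^+ 2 * harmonic_sum R D ^+ 4 =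
  8 * H%:R * B ^+ 2 * harmonic_sum R D ^+ 2 * (harmonic_sum R D * (2 * harmonic_sum R D)) by ring.
rewrite ler_wpM2l ?mulr_ge0 ?exprn_ge0 //.
have -> : \sum_(q : T | frac q) q.1%:R^-1 * (q.2%:R^-1 + ((q.1 - q.2)%N%:R)^-1) =
  \sum_(d : 'I_D.+1 | (0 < d)%N) (d%:R : R)^-1 *
    \sum_(j : 'I_D.+1 | (0 < j < d)%N) (j%:R^-1 + ((d - j)%N%:R)^-1).
  under [RHS]eq_bigr do rewrite mulr_sumr.
  rewrite pair_big_dep /=; apply: eq_bigl => p; rewrite /frac.
  by apply/idP/idP => /andP[a b]; rewrite ?b ?a ?andbT ?(leq_trans _ b) //; case/andP: b => -> ->.
apply: (@le_trans _ _ (\sum_(d : 'I_D.+1 | (0 < d)%N) (d%:R : R)^-1 * (2 * harmonic_sum R D))).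
  apply: ler_sum => d d0; rewrite ler_wpM2l ?invr_ge0 // big_split /= mulr_natl mulr2n.
  have dD : (d <= D)%N by rewrite -ltnS ltn_ord.
  apply: lerD.
    apply: (@sum_inv_le_harmonic _ _ _ _ (fun j : 'I_D.+1 => j : nat)) => // [j|j j' _ _ e].
      by move=> /andP[j0 jd]; rewrite j0 (leq_trans (ltnW jd)).
    exact: val_inj.
  apply: (@sum_inv_le_harmonic _ _ _ _ (fun j : 'I_D.+1 => (d - j)%N)) => // [j|j j'].
    by move=> /andP[j0 jd]; lia.
  by move=> /andP[_ a] /andP[_ b] e; apply: val_inj => /=; lia.
rewrite -mulr_suml ler_wpM2r ?mulr_ge0 //.
apply: (@sum_inv_le_harmonic _ _ _ _ (fun j : 'I_D.+1 => j : nat)) => // [j|j j' _ _ e].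
  by move=> ->; rewrite -ltnS ltn_ord.
exact: val_inj.
Qed.

(* Every y in (N - t, 2N - t] is a sum i + j with i, j <= 2N in at least N/2
   ways. *)
Lemma shift_energy_divisor_sum N H t : (0 < N)%N -> (2 * t <= N)%N ->
  shift_energy divisor_sum N H t <=
  16 * (18 * N%:R + 48 * (D ^ 2)%:R * harmonic_sum R (D ^ 2)) * H%:R * B ^+ 2 * harmonic_sum R D ^+ 4.
Proof.
move=> N0 tN; set L := (2 * N).+1.
(* Indexing by y = x - t replaces the backward shift by a forward one, as in the expansion into
   characters. *)
pose F y := (window divisor_sum H y - window divisor_sum H (y + t)) ^+ 2.
have F0 y : 0 <= F y by rewrite sqr_ge0.
have FE y : F y = normc (\sum_(q | farey q)
     farey_coef q * shift_symbol H t (expi (fv q)) * expi (fv q) ^+ y) ^+ 2.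
  by rewrite -window_divisor_sumE normc_real real_normK ?num_real.
have up : \sum_(i < L) \sum_(j < L) F (i + j)%N <=
    (L%:R ^+ 2 + 8 * L%:R * (D ^ 2)%:R * harmonic_sum R (D ^ 2)) *
    (16 * H%:R * B ^+ 2 * harmonic_sum R D ^+ 4).
  under eq_bigr do under eq_bigr do rewrite FE.
  have := @schur_sieve R _ (@farey D) (fun q => farey_coef q * shift_symbol H t (expi (fv q)))
    (fun q => expi (fv q)) L _ (fun r Fr => farey_row L Fr).
  move/le_trans; apply.
  by rewrite ler_wpM2l ?farey_coef_sum // addr_ge0 ?mulr_ge0 ?exprn_ge0 ?harmonic_sum_ge0.
set S := shift_energy _ _ _ _.
have SE : S = \sum_((N - t).+1 <= y < (2 * N - t).+1) F y.
  rewrite /S /shift_energy -[N.+1 in LHS](@subnK t) ?big_addn; last by lia.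
  rewrite !subSn; try by lia.
  by apply: eq_big_nat => y ty; rewrite addnK.
have low : (N - t).+1%:R * S <= \sum_(i < L) \sum_(j < L) F (i + j)%N.
  rewrite -(big_mkord xpredT (fun i => \sum_(j < L) F (i + j)%N)).
  rewrite (@big_cat_nat _ _ _ (N - t).+1) //=; last by rewrite /L; lia.
  rewrite -[leLHS]addr0 lerD //; last first.
    by apply: sumr_ge0 => i _; apply: sumr_ge0.
  have -> : (N - t).+1%:R * S = \sum_(0 <= i < (N - t).+1) S.
    by rewrite big_const_nat iter_addr_0 subn0 mulr_natl.
  apply: ler_sum_nat => i /andP[_ iN].
  rewrite -(big_mkord xpredT (fun j => F (i + j)%N)) SE.
  have -> : \sum_((N - t).+1 <= y < (2 * N - t).+1) F y =
     \sum_((N - t).+1 - i <= j < (2 * N - t).+1 - i) F (i + j)%N.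
    rewrite -{1}[(N - t).+1](@subnK i) ?big_addn; last by lia.
    by apply: eq_big_nat => y _; rewrite addnC.
  rewrite [leRHS](@big_cat_nat _ _ _ ((N - t).+1 - i)) //=; last by rewrite /L; lia.
  rewrite [X in _ <= _ + X](@big_cat_nat _ _ _ ((2 * N - t).+1 - i)) /=; try by rewrite /L; lia.
  by rewrite addrCA lerDl addr_ge0 ?sumr_ge0.
have S0 : 0 <= S by apply: shift_energy_ge0.
(* These two inequalities produce the constants 18 = 2 * 3^2 and 48 = 2 * 8 * 3 of the statement. *)
have Nt : N%:R <= 2 * (N - t).+1%:R :> R by rewrite -natrM ler_nat; lia.
have LN : L%:R <= 3 * N%:R :> R by rewrite -natrM ler_nat /L; lia.
have NR : 0 < (N%:R : R) by rewrite ltr0n.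
rewrite -(ler_pM2l NR).
apply: (@le_trans _ _ (2 * ((N - t).+1%:R * S))); first by rewrite mulrA ler_wpM2r.
apply: le_trans (ler_wpM2l _ (le_trans low up)) _ => //.
set Z := 16 * H%:R * B ^+ 2 * harmonic_sum R D ^+ 4.
have Z0 : 0 <= Z by rewrite !mulr_ge0 ?exprn_ge0 ?harmonic_sum_ge0.
set W := (D ^ 2)%:R * harmonic_sum R (D ^ 2).
have W0 : 0 <= W by rewrite mulr_ge0 ?harmonic_sum_ge0.
have -> : N%:R * (16 * (18 * N%:R + 48 * (D ^ 2)%:R * harmonic_sum R (D ^ 2)) * H%:R * B ^+ 2 * harmonic_sum R D ^+ 4)
  = 2 * (((3 * N%:R) ^+ 2 + 8 * (3 * N%:R) * W) * Z) by rewrite /W /Z; ring.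
rewrite (_ : L%:R ^+ 2 + _ = L%:R ^+ 2 + 8 * L%:R * W); last by rewrite /W; ring.
rewrite ler_pM2l // ler_wpM2r // lerD //.
  by rewrite lerXn2r ?nnegrE ?mulr_ge0.
by rewrite ler_wpM2r // ler_pM2l.
Qed.

End SmallDivisors.

(** * Large divisors *)

Section LargeDivisors.
Variable R : realType.
Implicit Types (g f : nat -> R).

Lemma dirichlet_oneE f n K : (0 < n <= K)%N ->
  dirichlet_one f n = \sum_(1 <= d < K.+1) (d %| n)%:R * f d.
Proof.
move=> /andP[n0 nK]; rewrite /dirichlet_one.
have -> : \sum_(1 <= d < K.+1) (d %| n)%:R * f d =
    \sum_(d <- [seq d <- index_iota 1 K.+1 | d %| n]%N) f d.
  rewrite big_filter [RHS]big_mkcond /=; apply: eq_bigr => d _.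
  by case: ifP => _; rewrite ?mul1r ?mul0r.
apply: perm_big; apply: uniq_perm; rewrite ?divisors_uniq ?filter_uniq ?iota_uniq //.
move=> d; rewrite -dvdn_divisors // mem_filter mem_index_iota.
case: (boolP (d %| n)%N) => //= dn; rewrite (dvdn_gt0 n0 dn) ltnS.
by rewrite (leq_trans (dvdn_leq n0 dn)).
Qed.

(** Writing n = d m and summing over the cofactor m first, the d that occur fill the interval (x/m,
    (x + H)/m]. *)
Lemma window_dirichlet f H x K : (x + H <= K)%N ->
  window (dirichlet_one f) H x =
  \sum_(1 <= m < K.+1) window f ((x + H) %/ m - x %/ m) (x %/ m).
Proof.
move=> xK.
transitivity (\sum_(1 <= d < K.+1) ((x + H) %/ d - x %/ d)%:R * f d).
  rewrite /window; under eq_big_nat => n nb.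
    rewrite (@dirichlet_oneE _ _ K); last by lia.
    over.
  rewrite exchange_big /=; apply: eq_bigr => d _.
  rewrite -mulr_suml -natr_sum; congr (_%:R * _).
  by rewrite !divn_count_dvd [X in (X - _)%N](@big_cat_nat _ _ _ x.+1) //= ?addKn // ltnS leq_addr.
have -> : \sum_(1 <= m < K.+1) window f ((x + H) %/ m - x %/ m) (x %/ m) =
  \sum_(1 <= m < K.+1) \sum_(1 <= d < K.+1) (x %/ m < d <= (x + H) %/ m)%N%:R * f d.
  apply: eq_big_nat => m /andP[m1 _].
  have le : (x %/ m <= (x + H) %/ m)%N by rewrite leq_div2r ?leq_addr.
  rewrite (@window_indicator _ _ _ _ K.+1) ?subnKC // ltnS.
  by rewrite (leq_trans (leq_div _ _)).
rewrite exchange_big /=; apply: eq_big_nat => d /andP[d1 _].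
rewrite -mulr_suml -natr_sum; congr (_%:R * _).
rewrite (eq_big_nat _ _ (F2 := fun m => (x %/ d < m <= (x + H) %/ d)%N : nat)).
  rewrite count_nat_between (minn_idPl _) //.
  by rewrite (leq_trans (leq_div _ _)).
move=> m /andP[m1 _]; congr nat_of_bool.
by rewrite !leq_divRL // !ltn_divLR // mulnC.
Qed.

Definition above D g n : R := if (n <= D)%N then 0 else g n.

Lemma dirichlet_one_split D g n : (0 < n)%N ->
  dirichlet_one g n = divisor_sum D g n + dirichlet_one (above D g) n.
Proof.
move=> n0; rewrite !(@dirichlet_oneE _ _ (n + D)) ?n0 ?leq_addr //.
rewrite !(@big_cat_nat _ _ _ D.+1 1 (n + D).+1) //=; try by rewrite ltnS leq_addl.
have -> : \sum_(1 <= d < D.+1) (d %| n)%:R * above D g d = 0.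
  rewrite big_nat_cond big1 // => d /andP[/andP[_ dD] _].
  by rewrite /above -ltnS dD mulr0.
rewrite add0r; congr (_ + _); apply: eq_big_nat => d /andP[Dd _].
by rewrite /above leqNgt Dd.
Qed.

Lemma sum_nat_divn (F : nat -> R) k a b : (0 < k)%N -> (a <= b)%N ->
  \sum_(a * k <= x < b * k) F (x %/ k)%N = k%:R * \sum_(a <= y < b) F y.
Proof.
move=> k0; elim: b => [|b IH] ab.
  by move: ab; rewrite leqn0 => /eqP ->; rewrite !big_geq // mulr0.
move: ab; rewrite leq_eqVlt => /predU1P[->|ab]; first by rewrite !big_geq // mulr0.
rewrite big_nat_recr //= mulrDr -IH //.
rewrite ltnS in ab.
rewrite (@big_cat_nat _ _ _ (b * k)) //=; try by rewrite leq_mul2r ?ab ?leqnSn orbT.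
congr (_ + _); rewrite -{1}[(b * k)%N]add0n big_addn mulSn addnK.
rewrite (eq_big_nat _ _ (F2 := fun=> F b)); last first.
  by move=> i /andP[_ ik]; rewrite addnC divnMDl // divn_small // addn0.
by rewrite big_const_nat iter_addr_0 subn0 mulr_natl.
Qed.

(** The quotients x/m lie in [N/m, 2(N/m) + 1], which has two endpoints more than the dyadic range
    at height N/m. *)
Lemma sum_dyadic_divn (F : nat -> R) N m : (0 < m)%N -> (forall y, 0 <= F y) ->
  \sum_(N.+1 <= x < (2 * N).+1) F (x %/ m)%N <=
  m%:R * \sum_(N %/ m <= y < (2 * (N %/ m)).+2) F y.
Proof.
move=> m0 F0; rewrite -sum_nat_divn //; last by move: (N %/ m)%N => n; lia.
have h1 : (N %/ m * m <= N)%N by exact: leq_trunc_div.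
have h2 : (N < (N %/ m).+1 * m)%N by exact: ltn_ceil.
rewrite [leRHS](@big_cat_nat _ _ _ N.+1) /=; try by lia.
rewrite [X in _ <= _ + X](@big_cat_nat _ _ _ (2 * N).+1) /=; try by lia.
by rewrite addrCA lerDl addr_ge0 ?sumr_ge0.
Qed.

Section Bounded.
Variables (g : nat -> R) (B : R) (N H : nat).
Hypothesis gB : forall n, (0 < n <= 4 * N)%N -> `|g n| <= B.
Hypothesis B0 : 0 <= B.
Hypothesis HN : (H <= N)%N.
Hypothesis N0 : (0 < N)%N.
Variable D : nat.

Local Notation gl := (above D g).

Lemma above_bound n : (0 < n <= 4 * N)%N -> `|gl n| <= B.
Proof. by rewrite /above; case: ifP => _ nb; [rewrite normr0|exact: gB]. Qed.

(** Below D - h both cut-off windows vanish, and from D + h on both agree with those of [g]; only y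
    within h of D needs the trivial bound. *)
Lemma window_above_diff h s y : (s <= h)%N -> (y + h <= 4 * N)%N ->
  (window gl h (y - s) - window gl h y) ^+ 2 <=
  (window g h (y - s) - window g h y) ^+ 2 +
  ((D < y + h) && (y < D + h))%N%:R * (2 * (h%:R * B)) ^+ 2.
Proof.
move=> sh yN; case: (leqP (y + h) D) => [yD|Dy] /=.
  have z x : (x <= y)%N -> window gl h x = 0.
    move=> xy; rewrite /window big_nat_cond big1 // => i /andP[/andP[_ i2] _].
    by rewrite /above ifT //; lia.
  by rewrite !z ?leq_subr // subrr expr0n addr_ge0 ?sqr_ge0 // mul0r.
case: (ltnP y (D + h)) => [yD|Dy'] /=.
  rewrite mul1r -[leLHS]add0r lerD ?sqr_ge0 //.
  exact: (@window_diff_sqr _ gl B (4 * N) above_bound).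
have e x : (D <= x)%N -> window gl h x = window g h x.
  move=> Dx; apply: eq_big_nat => i /andP[i1 _].
  by rewrite /above ifF //; lia.
by rewrite !e ?mul0r ?addr0 //; lia.
Qed.

(** Two roundings intervene: the interval (z/m, (z + H)/m] may hold one integer more than H/m,
    costing B for each of the two windows, and (x - t)/m may be one less than x/m - t/m, costing
    2B. *)
Lemma window_divn_diff m t x : (0 < m)%N -> (t <= x)%N -> (x <= 2 * N)%N -> (t <= H)%N ->
  forall q : nat -> R, (forall z, q z = window gl ((z + H) %/ m - z %/ m) (z %/ m)) ->
  (q (x - t)%N - q x) ^+ 2 <=
  2 * (window gl (H %/ m) (x %/ m - t %/ m) - window gl (H %/ m) (x %/ m)) ^+ 2
  + 32 * B ^+ 2.
Proof.
move=> m0 tx xN tH q qdef; set h := (H %/ m)%N; set y := (x %/ m)%N; set s := (t %/ m)%N.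
have qE z : (z <= 2 * N)%N -> `|q z - window gl h (z %/ m)| <= B.
  move=> zN; rewrite qdef divnD // -/h -addnA addKn windowD.
  rewrite addrAC subrr add0r.
  case: (m <= _)%N; last by rewrite /window big_geq ?normr0 // addn0.
  rewrite (le_trans (window_bound above_bound _)) ?mul1r //.
  have := leq_div z m; have := leq_div H m; rewrite -/h.
  have : (z %/ m + h <= (z + H) %/ m)%N by rewrite divnD // -addnA leq_add2l leq_addr.
  by have := leq_div (z + H) m; lia.
have sE : `|window gl h ((x - t) %/ m) - window gl h (y - s)| <= 2 * B.
  have : y = ((x - t) %/ m + s + (m <= (x - t) %% m + t %% m))%N.
    by rewrite /y -{1}(subnK tx) divnD.
  move=> yE; have -> : ((x - t) %/ m = y - s - (m <= (x - t) %% m + t %% m))%N by rewrite yE -subnDA -addnA addnK.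
  case: (m <= _)%N yE => yE; last by rewrite subn0 subrr normr0 mulr_ge0.
  have yx : (y <= x)%N by exact: leq_div.
  have hH : (h <= H)%N by exact: leq_div.
  have s1 : (s < y)%N by rewrite yE /= addn1 ltnS leq_addl.
  rewrite (le_trans (window_step above_bound _ _)) ?mul1r ?subn_gt0 //.
  rewrite (@leq_trans (y + h)) ?leq_add2r ?leq_subr // (leq_trans (leq_add yx hH)) //.
  by lia.
have -> : q (x - t)%N - q x = (window gl h (y - s) - window gl h y) +
  ((q (x - t)%N - window gl h ((x - t) %/ m)) +
   (window gl h ((x - t) %/ m) - window gl h (y - s)) - (q x - window gl h y)) by ring.
rewrite (le_trans (sqrD_le _ _)) // lerD //.
have -> : 32 * B ^+ 2 = 2 * (4 * B) ^+ 2 by ring.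
rewrite ler_pM2l // ler_sqr_norm // (le_trans (ler_normB _ _)) //.
have := qE x xN; have := qE (x - t)%N ltac:(lia).
have := ler_normD (q (x - t)%N - window gl h ((x - t) %/ m))
                  (window gl h ((x - t) %/ m) - window gl h (y - s)).
rewrite -/y; lra.
Qed.

End Bounded.
End LargeDivisors.

(** * Descent to height N/m and length H/m *)

Section LargePart.
Variable R : realType.
Variables (g : nat -> R) (B : R) (N H D : nat).
Hypothesis gB : forall n, (0 < n <= 4 * N)%N -> `|g n| <= B.
Hypothesis B0 : 0 <= B.
Hypothesis HN : (H <= N)%N.
Hypothesis N0 : (0 < N)%N.
Local Notation gl := (above D g).

Lemma sum_near_le (h a b : nat) :
  (\sum_(a <= y < b) ((D < y + h) && (y < D + h) : nat) <= 2 * h)%N.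
Proof.
apply: (@leq_trans (\sum_(1 <= u < (b + h).+1) ((D < u <= D + 2 * h) : nat))); last first.
  by rewrite count_nat_between leq_subLR geq_minl.
have e : (\sum_(a <= y < b) ((D < y + h) && (y < D + h) : nat) <=
   \sum_(0 <= y < b) ((D < y + h) && (y < D + h) : nat))%N.
  case: (leqP a b) => [ab|ba]; last by rewrite big_geq // ltnW.
  by rewrite [leqRHS](@big_cat_nat _ _ _ a) //= leq_addl.
apply: leq_trans e _.
apply: (@leq_trans (\sum_(h <= u < b + h) ((D < u <= D + 2 * h) : nat))).
  have -> : (\sum_(h <= u < b + h) ((D < u <= D + 2 * h) : nat) =
             \sum_(0 <= y < b) ((D < y + h <= D + 2 * h) : nat))%N.
    by rewrite -{1}[h]add0n big_addn addnK.
  apply: leq_sum => y _.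
  by case: (boolP (_ && _)) => // /andP[h1 h2]; rewrite h1 /= lt0b; lia.
case: (posnP h) => [->|h0].
  rewrite big1 // => u _; case: (boolP (D < u <= _)%N) => //; lia.
rewrite [leqRHS](@big_cat_nat _ _ _ h) //=; try lia.
by rewrite [X in (_ <= _ + X)%N]big_nat_recr /=; lia.
Qed.

(** The count 2(H/m) pays for the y near the cutoff D, and the further 2 for the endpoints N/m and
    2(N/m) + 1. *)
Lemma shift_energy_above m s : (0 < m)%N -> (s <= H %/ m)%N ->
  \sum_(N %/ m <= y < (2 * (N %/ m)).+2)
     (window gl (H %/ m) (y - s) - window gl (H %/ m) y) ^+ 2 <=
  shift_energy g (N %/ m) (H %/ m) s
  + (2 * (H %/ m) + 2)%N%:R * (2 * ((H %/ m)%:R * B)) ^+ 2.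
Proof.
move=> m0 sh; have hH := leq_div H m; have NN := leq_div N m.
move: (H %/ m)%N (N %/ m)%N sh hH NN => h N' sh hH NN.
set c := (2 * (h%:R * B)) ^+ 2; have c0 : 0 <= c by rewrite sqr_ge0.
apply: (@le_trans _ _ (\sum_(N' <= y < (2 * N').+2) ((window g h (y - s) - window g h y) ^+ 2
    + ((D < y + h) && (y < D + h))%N%:R * c))).
  apply: ler_sum_nat => y /andP[_ yN].
  by apply: (window_above_diff gB B0 HN N0 D sh); lia.
have gc y : (y <= (2 * N').+1)%N -> (window g h (y - s) - window g h y) ^+ 2 <= c.
  by move=> yN; apply: (window_diff_sqr gB); lia.
rewrite big_split /= -mulr_suml -natr_sum natrD mulrDl addrCA addrC lerD //.
  by rewrite ler_wpM2r // ler_nat sum_near_le.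
rewrite big_ltn; last by lia.
rewrite big_nat_recr /=; last by lia.
rewrite -/(shift_energy g N' h s) mulr_natl mulr2n addrCA lerD // lerD //; apply: gc; lia.
Qed.

Lemma sum_shift_energy_divn m : (0 < m)%N ->
  \sum_(1 <= t < H.+1) shift_energy g (N %/ m) (H %/ m) (t %/ m) <=
  m%:R * total_energy g (N %/ m) (H %/ m).
Proof.
move=> m0; have s0 : shift_energy g (N %/ m) (H %/ m) 0 = 0.
  by rewrite /shift_energy big1 // => x _; rewrite subn0 subrr expr0n.
have -> : total_energy g (N %/ m) (H %/ m) =
    \sum_(0 <= i < (H %/ m).+1) shift_energy g (N %/ m) (H %/ m) i.
  by rewrite [RHS]big_ltn // s0 add0r.
rewrite (le_trans _ (sum_divn_le H m0 (shift_energy_ge0 g _ _))) //.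
by rewrite [leRHS]big_ltn // div0n s0 add0r.
Qed.

(* The modulus m contributes the short interval problem for g at height N/m and
   length H/m; the weights 1/m in Cauchy's inequality lose only a logarithm. *)
Lemma total_energy_above M rho : 0 <= rho ->
  (3 * N < M.+1 * D.+1)%N ->
  (forall m, (0 < m <= M)%N -> (0 < H %/ m)%N /\
     total_energy g (N %/ m) (H %/ m) <=
     (H %/ m)%:R * ((N %/ m)%:R * (H %/ m)%:R ^+ 2) * rho) ->
  total_energy (dirichlet_one gl) N H <=
  harmonic_sum R M * H%:R * (2 * N%:R * H%:R ^+ 2 * rho * harmonic_sum R M
     + 32 * H%:R ^+ 3 * B ^+ 2 * harmonic_sum R M + 32 * B ^+ 2 * N%:R * M%:R ^+ 2).
Proof.
move=> rho0 MD gE; pose q m z := window gl ((z + H) %/ m - z %/ m) (z %/ m).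
have MN : (M <= 4 * N)%N.
  case: (posnP M) => [->//|M0]; have [h0 _] := gE M ltac:(lia).
  by move: h0; rewrite divn_gt0 //; lia.
(* Cofactors m > M drop out: there (z + H)/m <= 3N/m < D + 1, and [above D g] vanishes up to D. *)
have windowE z : (z <= 2 * N)%N -> window (dirichlet_one gl) H z = \sum_(1 <= m < M.+1) q m z.
  move=> zN; rewrite (@window_dirichlet _ _ _ _ (4 * N)); last by lia.
  rewrite (@big_cat_nat _ _ _ M.+1) //=.
  rewrite -[RHS]addr0; congr (_ + _); rewrite big_nat_cond big1 //.
  move=> m /andP[/andP[Mm _] _].
  have a1 : (z %/ m <= (z + H) %/ m)%N by rewrite leq_div2r ?leq_addr.
  have a2 : ((z + H) %/ m <= D)%N.
    rewrite -ltnS ltn_divLR; last by lia.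
    by rewrite mulnC (leq_trans _ (leq_mul Mm (leqnn D.+1))) //; lia.
  rewrite /window subnKC // big_nat_cond big1 // => i /andP[/andP[_ i2] _].
  by rewrite /above ifT // -ltnS (leq_trans i2).
pose z m t x := q m (x - t)%N - q m x.
have zE m t : (0 < m)%N -> (t <= H)%N ->
    \sum_(N.+1 <= x < (2 * N).+1) z m t x ^+ 2 <=
    2 * (m%:R * (shift_energy g (N %/ m) (H %/ m) (t %/ m)
      + (2 * (H %/ m) + 2)%N%:R * (2 * ((H %/ m)%:R * B)) ^+ 2))
    + 32 * B ^+ 2 * N%:R.
  move=> m0 tH.
  apply: (@le_trans _ _ (\sum_(N.+1 <= x < (2 * N).+1)
     (2 * (window gl (H %/ m) (x %/ m - t %/ m) - window gl (H %/ m) (x %/ m)) ^+ 2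
       + 32 * B ^+ 2))).
    apply: ler_sum_nat => x /andP[x1 x2].
    by apply: (@window_divn_diff _ g B N H gB B0 HN N0 D m t x _ _ _ _ (q m)) => //; lia.
  rewrite big_split /= big_const_nat iter_addr_0 subSS -[_ * B ^+ 2 *+ _]mulr_natr.
  rewrite (_ : (2 * N - N)%N = N); last by lia.
  rewrite lerD2r -mulr_sumr ler_pM2l //.
  apply: le_trans (@sum_dyadic_divn _ (fun y => (window gl (H %/ m) (y - t %/ m)
      - window gl (H %/ m) y) ^+ 2) N m m0 _) _; first by move=> y; rewrite sqr_ge0.
  by rewrite ler_wpM2l // shift_energy_above // leq_div2r.
have step1 : total_energy (dirichlet_one gl) N H <=
    harmonic_sum R M * \sum_(1 <= m < M.+1) m%:R * \sum_(1 <= t < H.+1)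
      \sum_(N.+1 <= x < (2 * N).+1) z m t x ^+ 2.
  have -> : \sum_(1 <= m < M.+1) m%:R * (\sum_(1 <= t < H.+1)
      \sum_(N.+1 <= x < (2 * N).+1) z m t x ^+ 2) =
    \sum_(1 <= t < H.+1) \sum_(N.+1 <= x < (2 * N).+1)
      \sum_(1 <= m < M.+1) m%:R * z m t x ^+ 2.
    under eq_bigr do rewrite mulr_sumr.
    rewrite exchange_big /=; apply: eq_bigr => t _.
    under eq_bigr do rewrite mulr_sumr.
    by rewrite exchange_big.
  rewrite mulr_sumr; apply: ler_sum_nat => t /andP[_ tH].
  rewrite mulr_sumr; apply: ler_sum_nat => x /andP[Nx xN].
  rewrite !windowE; try lia.
  rewrite -sumrB.
  rewrite [X in _ <= _ * X](eq_bigr (fun m => z m t x ^+ 2 / m%:R^-1)); last first.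
    by move=> m _; rewrite invrK mulrC.
  apply: (@sqr_sum_weighted R _ (index_iota 1 M.+1) (fun m => m%:R^-1) (fun m => z m t x)).
  by move=> m; rewrite mem_index_iota => /andP[m1 _]; rewrite invr_gt0 ltr0n.
apply: le_trans step1 _; rewrite -mulrA ler_wpM2l ?harmonic_sum_ge0 //.
have h0 := harmonic_sum_ge0 R M.
apply: (@le_trans _ _ (\sum_(1 <= m < M.+1) H%:R *
   ((2 * N%:R * H%:R ^+ 2 * rho + 32 * H%:R ^+ 3 * B ^+ 2) * m%:R^-1
     + 32 * B ^+ 2 * N%:R * M%:R))); last first.
  rewrite -mulr_sumr ler_wpM2l // big_split /= -mulr_sumr -/(harmonic_sum R M).
  rewrite big_const_nat iter_addr_0 subn1 /= -[_ * M%:R *+ _]mulr_natr.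
  by rewrite le_eqVlt; apply/orP; left; apply/eqP; ring.
apply: ler_sum_nat => m /andP[m1 mM].
have [hp gEm] := gE m ltac:(lia).
have mR : 0 < (m%:R : R) by rewrite ltr0n.
have mh : m%:R * (H %/ m)%:R <= H%:R :> R by rewrite -natrM ler_nat mulnC leq_trunc_div.
have mN : m%:R * (N %/ m)%:R <= N%:R :> R by rewrite -natrM ler_nat mulnC leq_trunc_div.
have mMR : m%:R <= M%:R :> R by rewrite ler_nat.
set h : R := (H %/ m)%:R in mh gEm *; set n : R := (N %/ m)%:R in mN gEm *.
have h1 : 1 <= h by rewrite /h ler1n.
have n0 : 0 <= n by [].
apply: (@le_trans _ _ (m%:R * (2 * m%:R * (m%:R * (h * (n * h ^+ 2) * rho)
    + H%:R * (4 * h * (2 * (h * B)) ^+ 2)) + H%:R * (32 * B ^+ 2 * N%:R)))).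
  rewrite ler_pM2l //.
  apply: (@le_trans _ _ (\sum_(1 <= t < H.+1) (2 * m%:R *
     (shift_energy g (N %/ m) (H %/ m) (t %/ m) + 4 * h * (2 * (h * B)) ^+ 2)
      + 32 * B ^+ 2 * N%:R))).
    apply: ler_sum_nat => t /andP[_ tH].
    apply: le_trans (zE m t m1 tH) _.
    rewrite lerD2r mulrA ler_wpM2l ?mulr_ge0 // lerD2l ler_wpM2r ?sqr_ge0 //.
    by rewrite natrD natrM -/h; lra.
  rewrite big_split /= big_const_nat iter_addr_0 subn1 /= -[_ * N%:R *+ _]mulr_natl.
  rewrite lerD2r -mulr_sumr ler_wpM2l ?mulr_ge0 //.
  rewrite big_split /= big_const_nat iter_addr_0 subn1 /= -[_ * _ ^+ 2 *+ _]mulr_natl lerD2r.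
  by apply: le_trans (sum_shift_energy_divn m1) _; rewrite ler_wpM2l.
have B2 : 0 <= B ^+ 2 by rewrite sqr_ge0.
have HR : 0 <= (H%:R : R) by [].
have mh0 : 0 <= m%:R * h by rewrite mulr_ge0.
have c3 : (m%:R * h) ^+ 3 <= H%:R ^+ 3 by rewrite lerXn2r ?nnegrE.
(* The three factors m come from the Cauchy weight and from the fibres of x/m and t/m; with h^3 n
   they make up (mh)^3 (mn) / m. *)
have t1 : m%:R * (2 * m%:R * (m%:R * (h * (n * h ^+ 2) * rho))) <=
          H%:R * (2 * N%:R * H%:R ^+ 2 * rho * m%:R^-1).
  have -> : m%:R * (2 * m%:R * (m%:R * (h * (n * h ^+ 2) * rho))) =
    2 * rho * m%:R^-1 * ((m%:R * h) ^+ 3 * (m%:R * n)).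
    by field; rewrite gt_eqF.
  have -> : H%:R * (2 * N%:R * H%:R ^+ 2 * rho * m%:R^-1) =
    2 * rho * m%:R^-1 * (H%:R ^+ 3 * N%:R) by ring.
  rewrite ler_wpM2l ?mulr_ge0 ?invr_ge0 ?(ltW mR) // ler_pM ?exprn_ge0 ?mulr_ge0 //.
have t2 : m%:R * (2 * m%:R * (H%:R * (4 * h * (2 * (h * B)) ^+ 2))) <=
          H%:R * (32 * H%:R ^+ 3 * B ^+ 2 * m%:R^-1).
  have -> : m%:R * (2 * m%:R * (H%:R * (4 * h * (2 * (h * B)) ^+ 2))) =
    32 * H%:R * B ^+ 2 * m%:R^-1 * (m%:R * h) ^+ 3.
    by field; rewrite gt_eqF.
  have -> : H%:R * (32 * H%:R ^+ 3 * B ^+ 2 * m%:R^-1) =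
    32 * H%:R * B ^+ 2 * m%:R^-1 * H%:R ^+ 3 by ring.
  by rewrite ler_wpM2l ?mulr_ge0 ?invr_ge0 ?(ltW mR).
have t3 : m%:R * (H%:R * (32 * B ^+ 2 * N%:R)) <= H%:R * (32 * B ^+ 2 * N%:R * M%:R).
  rewrite [leRHS](_ : _ = M%:R * (H%:R * (32 * B ^+ 2 * N%:R))); last by ring.
  by rewrite ler_wpM2r ?mulr_ge0.
by move: t1 t2 t3; lra.
Qed.

End LargePart.

(** * Exponents and asymptotics *)

Section Finite.
Variable R : realType.
Implicit Types (g : nat -> R) (T : R).

(** With lam = T^(-20) the saving T^40 in J leaves T^18 at length h/k, the limit being the term lam
    N (hT)^2. Passing to length h loses k^5 against the k^3 of the rescaled target, hence T^2, and
    the sum 46 = 6 + 8 + 32 of the constants costs one more T. *)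
Lemma interp_bound g N h k T :
  100 <= T -> (forall n, (0 < n <= 4 * N)%N -> `|g n| <= T) ->
  (0 < k)%N -> k%:R <= T -> (0 < h %/ k)%N ->
  Jwprime g N (h %/ k) * T ^+ 40 <= N%:R * (h %/ k)%:R ^+ 2 ->
  h%:R * T ^+ 40 <= N%:R -> T ^+ 40 <= h%:R ->
  total_energy g N h * T ^+ 15 <= h%:R * (N%:R * h%:R ^+ 2).
Proof.
move=> T100 gT k0 kT h0 J40 hN Th.
have T0 : 0 < T by lra.
have T1 : 1 <= T by lra.
have TX n : 0 < T ^+ n by rewrite exprn_gt0.
have TX1 n : 1 <= T ^+ n by rewrite exprn_ege1.
have hNn : (h <= N)%N.
  by rewrite -(ler_nat R) (le_trans _ hN) // ler_peMr.
have hh : (h %/ k <= h)%N by exact: leq_div.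
have N0 : (0 < N)%N by rewrite (leq_trans h0) // (leq_trans hh).
have e1 := total_energy_interp gT k0 N0 hNn.
have lam0 : 0 < (T ^+ 20)^-1 by rewrite invr_gt0.
have e2 := total_energy_le h0 (leq_trans hh hNn) lam0 gT.
have kh : k%:R * (h %/ k)%:R <= h%:R :> R.
  by rewrite -natrM ler_nat mulnC leq_trunc_div.
move: e1 e2 kh J40; set u : R := (h %/ k)%:R; set J := Jwprime g N _.
set K : R := k%:R; set X : R := h%:R in hN Th *; set n : R := N%:R in hN *.
set E0 := total_energy g N (h %/ k) => e1 e2 kh J40.
have K1 : 1 <= K by rewrite /K ler1n.
have u0 : 0 <= u by [].
have uX : u <= X by rewrite (le_trans _ kh) // ler_peMl.
have X0 : 0 < X by rewrite (lt_le_trans (TX 40%N)).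
have n0 : 0 < n by rewrite (lt_le_trans _ hN) // mulr_gt0.
have a1 : u * (u * T) ^+ 2 * T ^+ 18 <= n * u ^+ 2.
  have -> : u * (u * T) ^+ 2 * T ^+ 18 = u ^+ 2 * (u * T ^+ 20) by ring.
  rewrite [leRHS]mulrC ler_wpM2l ?exprn_ge0 // (le_trans _ hN) //.
  by rewrite ler_pM ?(ltW (TX _)) // ler_weXn2l.
have a2 : (T ^+ 20)^-1 * n * (u * T) ^+ 2 * T ^+ 18 = n * u ^+ 2.
  by field; rewrite gt_eqF.
have a3 : J / (T ^+ 20)^-1 * T ^+ 18 <= n * u ^+ 2.
  rewrite invrK (le_trans _ J40) // -mulrA -exprD ler_wpM2l //.
    by apply: sumr_ge0 => x _; rewrite exprn_ge0.
  by rewrite ler_weXn2l.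
have E0b : E0 * T ^+ 18 <= u * (3 * (n * u ^+ 2)).
  rewrite (le_trans (ler_wpM2r (ltW (TX 18%N)) e2)) // -[leLHS]mulrA ler_wpM2l //.
  by rewrite !mulrDl a2; lra.
have Y0 : 0 <= X * (n * X ^+ 2) by rewrite !mulr_ge0 // ltW.
set Y := X * (n * X ^+ 2) in Y0 *.
have b1 : 2 * K ^+ 5 * E0 * T ^+ 16 <= 6 * Y.
  rewrite -(ler_pM2r (TX 2%N)).
  have -> : 2 * K ^+ 5 * E0 * T ^+ 16 * T ^+ 2 = 2 * K ^+ 5 * (E0 * T ^+ 18) by ring.
  rewrite (le_trans (ler_wpM2l _ E0b)) ?mulr_ge0 ?exprn_ge0 //.
  have -> : 2 * K ^+ 5 * (u * (3 * (n * u ^+ 2))) = 6 * n * ((K * u) ^+ 3 * K ^+ 2) by ring.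
  have -> : 6 * Y * T ^+ 2 = 6 * n * (X ^+ 3 * T ^+ 2) by rewrite /Y; ring.
  have Ku : (K * u) ^+ 3 <= X ^+ 3 by rewrite lerXn2r ?nnegrE ?mulr_ge0 ?(ltW X0).
  have KT : K ^+ 2 <= T ^+ 2 by rewrite lerXn2r ?nnegrE ?(ltW T0).
  by rewrite ler_wpM2l ?mulr_ge0 ?(ltW n0) // ler_pM ?exprn_ge0 ?mulr_ge0.
have b2 : X * (8 * K ^+ 4 * X * (u * T) ^+ 2) * T ^+ 16 <= 8 * Y.
  have -> : X * (8 * K ^+ 4 * X * (u * T) ^+ 2) * T ^+ 16 =
            8 * X * (((K * u) ^+ 2 * K ^+ 2) * (X * T ^+ 18)) by ring.
  have -> : 8 * Y = 8 * X * (X ^+ 2 * n) by rewrite /Y; ring.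
  rewrite ler_wpM2l ?mulr_ge0 ?(ltW X0) //.
  have Ku : (K * u) ^+ 2 <= X ^+ 2 by rewrite lerXn2r ?nnegrE ?mulr_ge0 ?(ltW X0).
  have KT : K ^+ 2 <= T ^+ 2 by rewrite lerXn2r ?nnegrE ?(ltW T0).
  have -> : (K * u) ^+ 2 * K ^+ 2 * (X * T ^+ 18) = (K * u) ^+ 2 * (K ^+ 2 * (X * T ^+ 18)) by ring.
  rewrite ler_pM ?exprn_ge0 ?mulr_ge0 ?exprn_ge0 ?(ltW X0) ?(ltW T0) //.
  rewrite (le_trans (ler_wpM2r _ KT)) ?mulr_ge0 ?exprn_ge0 ?(ltW X0) ?(ltW T0) //.
  rewrite mulrCA -exprD (le_trans _ hN) // ler_wpM2l ?(ltW X0) //.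
  by rewrite ler_weXn2l.
have b3 : X * (32 * K ^+ 4 * T ^+ 2 * n) * T ^+ 16 <= 32 * Y.
  have -> : X * (32 * K ^+ 4 * T ^+ 2 * n) * T ^+ 16 = 32 * X * n * (K ^+ 4 * T ^+ 18) by ring.
  have -> : 32 * Y = 32 * X * n * X ^+ 2 by rewrite /Y; ring.
  rewrite ler_wpM2l ?mulr_ge0 ?(ltW X0) ?(ltW n0) //.
  have KT : K ^+ 4 <= T ^+ 4 by rewrite lerXn2r ?nnegrE ?(ltW T0).
  rewrite (le_trans (ler_wpM2r (ltW (TX 18%N)) KT)) // -exprD.
  have : (T ^+ 40) ^+ 2 <= X ^+ 2 by rewrite lerXn2r ?nnegrE ?(ltW X0) ?(ltW (TX _)).
  by apply: le_trans; rewrite -exprM ler_weXn2l.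
rewrite -(ler_pM2r T0) -mulrA -exprSr.
have : total_energy g N h * T ^+ 16 <= 46 * Y.
  rewrite (le_trans (ler_wpM2r (ltW (TX 16%N)) e1)) // mulrDl [X * (_ + _)]mulrDr mulrDl.
  by move: b1 b2 b3; lra.
by move/le_trans; apply; rewrite mulrC ler_wpM2l //; lra.
Qed.

Lemma total_energy_dirichlet_split g D N H : total_energy (dirichlet_one g) N H <=
   2 * total_energy (divisor_sum D g) N H + 2 * total_energy (dirichlet_one (above D g)) N H.
Proof.
rewrite /total_energy !mulr_sumr -big_split /=; apply: ler_sum => t _.
rewrite /shift_energy !mulr_sumr -big_split /=; apply: ler_sum => x _.
have e y : window (dirichlet_one g) H y =
    window (divisor_sum D g) H y + window (dirichlet_one (above D g)) H y.
  rewrite /window -big_split /=; apply: eq_big_nat => i /andP[yi _].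
  by apply: dirichlet_one_split; rewrite (leq_trans _ yi).
apply: le_trans (sqrD_le _ _); rewrite !e le_eqVlt; apply/orP; left; apply/eqP.
by congr (_ ^+ 2); ring.
Qed.

(** Of the saving T^5 at the heights N/m two factors T go into harmonic sums; the remaining T^3 is
    the source of the 3 G' in the theorem. *)
Lemma final_finite g N H D M T :
  2000 <= T -> (forall n, (0 < n <= 4 * N)%N -> `|g n| <= T) ->
  (D <= N)%N -> (3 * N < M.+1 * D.+1)%N ->
  harmonic_sum R M <= T -> harmonic_sum R D <= T -> harmonic_sum R (D ^ 2) <= T ->
  T ^+ 20 <= H%:R -> H%:R * T ^+ 20 <= N%:R ->
  M%:R * T ^+ 20 <= H%:R -> (D ^ 2)%:R * T ^+ 20 <= N%:R * H%:R ->
  (forall m, (0 < m <= M)%N -> (0 < H %/ m)%N /\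
     total_energy g (N %/ m) (H %/ m) * T ^+ 5 <=
     (H %/ m)%:R * ((N %/ m)%:R * (H %/ m)%:R ^+ 2)) ->
  Jwprime (dirichlet_one g) N H * T ^+ 3 <= 12 * (N%:R * H%:R ^+ 2).
Proof.
move=> T2000 gT DN MD hM hD hDD TH HN MH DH gE.
have T0 : 0 < T by lra.
have T1 : 1 <= T by lra.
have TX n : 0 < T ^+ n by rewrite exprn_gt0.
have H0 : (0 < H)%N by rewrite -(ltr0n R) (lt_le_trans (TX 20%N)).
have T20 : 2 <= T ^+ 20 by rewrite (le_trans _ (ler_eXnr _ T1)) //; lra.
have HN2 : (2 * H <= N)%N.
  have p : 0 <= (H%:R : R) * (T ^+ 20 - 2).
    by apply: mulr_ge0 (ler0n _ _) _; rewrite subr_ge0; exact: T20.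
  by move: p HN; rewrite -(ler_nat R) natrM; lra.
have HNn : (H <= N)%N by apply: leq_trans HN2; rewrite leq_pmull.
have N0 : (0 < N)%N by exact: leq_trans HNn.
set X : R := H%:R in TH HN MH DH *; set n : R := N%:R in HN DH *.
have X0 : 0 < X by rewrite /X ltr0n.
have n0 : 0 < n by rewrite /n ltr0n.
have hM0 := harmonic_sum_ge0 R M; have hD0 := harmonic_sum_ge0 R D; have hDD0 := harmonic_sum_ge0 R (D ^ 2).
have f0 := total_energy_dirichlet_split g D N H.
(* For each t the sieve gives NH + D^2 H up to powers of T, to be compared with N H^2: the first
   term uses T^20 <= H, the second D^2 T^20 <= NH. *)
have small : total_energy (divisor_sum D g) N H * T ^+ 3 <= X * (n * X ^+ 2).
  have gD d : (0 < d <= D)%N -> `|g d| <= T.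
    move=> /andP[d0 dD]; apply: gT; rewrite d0 (leq_trans dD) // (leq_trans DN) //.
    by rewrite leq_pmull.
  have s t : (0 < t < H.+1)%N -> shift_energy (divisor_sum D g) N H t <=
      16 * (18 * n + 48 * (D ^ 2)%:R * T) * X * T ^+ 2 * T ^+ 4.
    move=> th; apply: le_trans (shift_energy_divisor_sum gD (ltW T0) H N0 _) _.
      by case/andP: th => _ th; rewrite (leq_trans _ HN2) // leq_mul2l -ltnS.
    have hp : harmonic_sum R D ^+ 4 <= T ^+ 4 by rewrite lerXn2r ?nnegrE ?(ltW T0).
    have dT : (D ^ 2)%:R * harmonic_sum R (D ^ 2) <= (D ^ 2)%:R * T by rewrite ler_wpM2l.
    have T20' := ltW (TX 2%N); have T40 := ltW (TX 4%N).
    apply: ler_pM.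
    - apply: mulr_ge0 T20'; apply: mulr_ge0 (ltW X0); apply: mulr_ge0 => //.
      by apply: addr_ge0; [apply: mulr_ge0|apply: mulr_ge0 hDD0; apply: mulr_ge0].
    - by rewrite exprn_ge0.
    - apply: ler_wpM2r (T20') _ _ _; apply: ler_wpM2r (ltW X0) _ _ _.
      by rewrite -/n; move: dT; lra.
    - exact: hp.
  have := ler_sum_const s; rewrite subn1 /= -/(total_energy _ N H) -/X => s'.
  apply: le_trans (ler_wpM2r (ltW (TX 3%N)) s') _.
  rewrite [leLHS](_ : _ = X * (288 * (n * X * T ^+ 9)
     + 768 * (X * ((D ^ 2)%:R * T ^+ 10)))); last by ring.
  apply: (ler_wpM2l (ltW X0)).
  have nX0 : 0 <= n * X := mulr_ge0 (ltW n0) (ltW X0).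
  have c1 : n * X * T ^+ 9 * T <= n * X ^+ 2.
    rewrite [leLHS](_ : _ = n * X * T ^+ 10); last by ring.
    rewrite [leRHS](_ : _ = n * X * X); last by ring.
    by apply: (ler_wpM2l nX0); apply: le_trans TH; rewrite ler_weXn2l.
  have c2 : X * ((D ^ 2)%:R * T ^+ 10) * T <= n * X ^+ 2.
    rewrite [leLHS](_ : _ = X * ((D ^ 2)%:R * T ^+ 11)); last by ring.
    rewrite [leRHS](_ : _ = X * (n * X)); last by ring.
    apply: (ler_wpM2l (ltW X0)); apply: le_trans DH; apply: ler_wpM2l => //.
    by rewrite ler_weXn2l.
  have p1 : 0 <= n * X * T ^+ 9 := mulr_ge0 nX0 (ltW (TX 9%N)).
  have p2 : 0 <= X * ((D ^ 2)%:R * T ^+ 10) := mulr_ge0 (ltW X0) (mulr_ge0 (ler0n _ _) (ltW (TX 10%N))).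
  have d1 := ler_wpM2l p1 T2000; have d2 := ler_wpM2l p2 T2000.
  have q : 0 <= n * X ^+ 2 by rewrite mulr_ge0 ?exprn_ge0 ?(ltW n0) ?(ltW X0).
  by move: c1 c2 d1 d2; set A := n * X * T ^+ 9 in p1 *; set A' := X * (_ * T ^+ 10) in p2 *;
    set A'' := n * X ^+ 2 in q *; lra.
(* Besides the main term, the edge terms are absorbed by H T^20 <= N and the rounding errors by M
   T^20 <= H. *)
have large : total_energy (dirichlet_one (above D g)) N H * T ^+ 3 <= 4 * (X * (n * X ^+ 2)).
  have rho0 : 0 <= (T ^+ 5)^-1 by rewrite invr_ge0 ltW.
  have gE' m : (0 < m <= M)%N -> (0 < H %/ m)%N /\
     total_energy g (N %/ m) (H %/ m) <=
     (H %/ m)%:R * ((N %/ m)%:R * (H %/ m)%:R ^+ 2) * (T ^+ 5)^-1.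
    by move=> mM; have [h0 e] := gE m mM; split=> //; rewrite ler_pdivlMr.
  have := total_energy_above gT (ltW T0) HNn N0 rho0 MD gE'; rewrite -/X -/n.
  set E := total_energy _ N H => eE.
  have eE2 : E <= T * X * (2 * n * X ^+ 2 * (T ^+ 5)^-1 * T + 32 * X ^+ 3 * T ^+ 2 * T
      + 32 * T ^+ 2 * n * M%:R ^+ 2).
    apply: le_trans eE _.
    have X30 : 0 <= 32 * X ^+ 3 * T ^+ 2 by rewrite !mulr_ge0 ?exprn_ge0 ?(ltW X0) ?(ltW T0).
    have a0 : 0 <= 2 * n * X ^+ 2 * (T ^+ 5)^-1.
      by rewrite !mulr_ge0 ?exprn_ge0 ?(ltW X0) ?(ltW n0).
    have a1 : 0 <= 32 * T ^+ 2 * n * M%:R ^+ 2.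
      by rewrite !mulr_ge0 ?exprn_ge0 ?(ltW T0) ?(ltW n0).
    have X20 : 0 <= 32 * X ^+ 3 * T ^+ 2 * harmonic_sum R M := mulr_ge0 X30 hM0.
    apply: ler_pM.
    - exact: mulr_ge0 hM0 (ltW X0).
    - exact: addr_ge0 (addr_ge0 (mulr_ge0 a0 hM0) X20) a1.
    - exact: (ler_wpM2r (ltW X0) hM).
    rewrite lerD2r; apply: lerD; first exact: (ler_wpM2l a0 hM).
    exact: (ler_wpM2l X30 hM).
  apply: le_trans (ler_wpM2r (ltW (TX 3%N)) eE2) _.
  have -> : T * X * (2 * n * X ^+ 2 * (T ^+ 5)^-1 * T + 32 * X ^+ 3 * T ^+ 2 * T
      + 32 * T ^+ 2 * n * M%:R ^+ 2) * T ^+ 3 =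
    X * (2 * (n * X ^+ 2) + (X ^+ 2 * (32 * (X * T ^+ 7)) + n * (32 * (M%:R ^+ 2 * T ^+ 6)))).
    by field; rewrite gt_eqF.
  have -> : 4 * (X * (n * X ^+ 2)) = X * (2 * (n * X ^+ 2) + (X ^+ 2 * n + n * X ^+ 2)) by ring.
  apply: (ler_wpM2l (ltW X0)); rewrite lerD2l; apply: lerD.
    apply: ler_wpM2l; first by rewrite exprn_ge0 ?(ltW X0).
    apply: le_trans HN; rewrite [leLHS](_ : _ = X * (32 * T ^+ 7)); last by ring.
    apply: (ler_wpM2l (ltW X0)); apply: (@le_trans _ _ (T * T ^+ 7)).
      by apply: (ler_wpM2r (ltW (TX 7%N))); lra.
    by rewrite -exprS ler_weXn2l.
  apply: (ler_wpM2l (ltW n0)).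
  have : (M%:R * T ^+ 20) ^+ 2 <= X ^+ 2.
    apply: lerXn2r; rewrite ?nnegrE; [|exact: ltW X0|exact: MH].
    exact: mulr_ge0 (ler0n _ _) (ltW (TX 20%N)).
  apply: le_trans; rewrite exprMn -exprM.
  rewrite [leLHS](_ : _ = M%:R ^+ 2 * (32 * T ^+ 6)); last by ring.
  apply: ler_wpM2l; first by rewrite exprn_ge0.
  apply: (@le_trans _ _ (T * T ^+ 6)).
    by apply: (ler_wpM2r (ltW (TX 6%N))); lra.
  by rewrite -exprS ler_weXn2l.
have := Jwprime_le (dirichlet_one g) H0 HNn; rewrite -/X => Jle.
rewrite -(ler_pM2l X0) [leLHS]mulrA.
apply: le_trans (ler_wpM2r (ltW (TX 3%N)) (le_trans Jle f0)) _.
rewrite mulrDl; set A := X * (n * X ^+ 2) in small large.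
have -> : X * (12 * (n * X ^+ 2)) = 12 * A by rewrite /A; ring.
have A0 : 0 <= A by rewrite !mulr_ge0 ?exprn_ge0 ?(ltW X0) ?(ltW n0).
by move: small large; lra.
Qed.

End Finite.

(** * Eventual bounds for g and for logarithms *)

Section Asymptotics.
Local Open Scope classical_set_scope.
Variable R : realType.
Implicit Types (g f : nat -> R).

Lemma vinogradovP f (g : nat -> R) : vinogradov f g <->
  exists2 k : R, 0 < k & \forall n \near \oo, `|f n| <= k * `|g n|.
Proof. exact: eqO_exP. Qed.

Lemma powR_ge_near (e c : R) : 0 < e -> \forall N \near \oo, c <= N%:R `^ e.
Proof.
move=> e0; set c' := Num.max c 1.
have c1 : 1 <= c' by rewrite le_max lexx orbT.
near=> N.
rewrite (@le_trans _ _ c') ?le_max ?lexx //.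
have -> : c' = (c' `^ e^-1) `^ e.
  by rewrite -powRrM mulVf ?gt_eqF // powRr1 // (le_trans ler01).
rewrite ge0_ler_powR ?nnegrE ?powR_ge0 ?(ltW e0) //.
by near: N; apply: nbhs_infty_ger.
Unshelve. all: by end_near. Qed.

(** The bound with exponent e/2 holds only from some n0 on. The finitely many earlier values enter
    through their sum S, and the spare factor N^(e/2) absorbs all constants. *)
Lemma ess_bounded_near g (e : R) : ess_bounded g -> 0 < e ->
  \forall N \near \oo, forall n, (0 < n <= 4 * N)%N -> `|g n| <= N%:R `^ e.
Proof.
move=> gb e0; have e2 : 0 < e / 2 by rewrite divr_gt0.
have /vinogradovP[k k0 [n0 _ gk]] := gb _ e2.
set S := \sum_(i < n0) `|g i|.
have S0 : 0 <= S by apply: sumr_ge0.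
near=> N => n /andP[np nN].
have N1 : 1 <= (N%:R : R) by near: N; apply: nbhs_infty_ger.
set Y := N%:R `^ (e / 2).
have Y1 : 1 <= Y by rewrite /Y; near: N; apply: powR_ge_near.
have YS : S + k * 4 `^ (e / 2) <= Y by rewrite /Y; near: N; apply: powR_ge_near.
have k4 : 0 <= k * 4 `^ (e / 2) by rewrite mulr_ge0 ?powR_ge0 ?(ltW k0).
have -> : N%:R `^ e = Y * Y.
  rewrite /Y -powRD; first by congr (_ `^ _); field.
  by apply/implyP => _; rewrite gt_eqF // (lt_le_trans ltr01).
have gn : `|g n| <= S + k * 4 `^ (e / 2) * Y.
  case: (leqP n0 n) => [nn|nn].
    rewrite (le_trans (gk _ nn)) // -[leLHS]add0r lerD //.
    rewrite ger0_norm ?powR_ge0 // -mulrA ler_pM2l // -powRM //.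
    by rewrite ge0_ler_powR ?nnegrE ?(ltW e2) // -natrM ler_nat.
  rewrite -[leLHS]addr0 lerD ?mulr_ge0 ?(ltW k0) ?powR_ge0 //.
  rewrite /S (bigD1 (Ordinal nn)) //= lerDl sumr_ge0 //.
rewrite (le_trans gn) //.
have Y0 : 0 <= Y by rewrite (le_trans ler01).
apply: (@le_trans _ _ ((S + k * 4 `^ (e / 2)) * Y)); last by rewrite ler_wpM2r.
by rewrite mulrDl lerD2r ler_peMr.
Unshelve. all: by end_near. Qed.

Lemma harmonic_sum_le_ln n : harmonic_sum R n <= 1 + ln (n%:R : R).
Proof.
elim: n => [|n IH]; first by rewrite /harmonic_sum big_geq // ln0 // addr0.
case: n IH => [|n] IH.
  by rewrite /harmonic_sum big_nat1 invr1 ln1 addr0.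
rewrite /harmonic_sum big_nat_recr //= -/(harmonic_sum R n.+1).
set m : R := n.+1%:R in IH *; set M : R := n.+2%:R.
have mM : M = m + 1 by rewrite /M -natr1.
have m0 : 0 < m by rewrite ltr0n.
have M0 : 0 < M by rewrite ltr0n.
(* This says 1/M <= ln M - ln (M - 1), the increment needed for the induction. *)
have : ln (1 + - M^-1) <= - M^-1.
  by apply: le_ln1Dx; rewrite ltrN2 invf_lt1 // mM; lra.
have -> : 1 + - M^-1 = m / M.
  have Mn : M != 0 by rewrite gt_eqF.
  by have -> : m = M - 1; [rewrite mM; ring|field].
rewrite ln_div ?posrE //; move: IH. move: (ln m) (ln M) (M^-1) (harmonic_sum R n.+1) => a b c d; lra.
Qed.

(** The argument 3N^2 dominates M, D and D^2, so one bound serves the three harmonic sums of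
    [final_finite]. *)
Lemma harmonic_sum_near (e : R) : 0 < e ->
  \forall N \near \oo, harmonic_sum R (3 * N ^ 2) <= N%:R `^ e.
Proof.
move=> e0; have e4 : 0 < e / 4 by rewrite divr_gt0.
near=> N.
have N1 : 1 <= (N%:R : R) by near: N; apply: nbhs_infty_ger.
have N0 : 0 < (N%:R : R) by rewrite (lt_le_trans ltr01).
set Y := N%:R `^ (e / 4).
have Y1 : 1 <= Y by rewrite /Y; near: N; apply: powR_ge_near.
have Yc : 1 + ln 3 + 8 / e <= Y by rewrite /Y; near: N; apply: powR_ge_near.
have Y0 : 0 < Y by rewrite (lt_le_trans ltr01).
rewrite (le_trans (harmonic_sum_le_ln _)) // natrM natrX lnM ?posrE ?exprn_gt0 // lnXn //.
have lnN : ln N%:R <= 4 / e * Y.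
  have : ln Y <= Y by rewrite ltW // ln_sublinear.
  rewrite ln_powR -ler_pdivlMl // => h; rewrite (le_trans h) //.
  by rewrite invf_div.
have -> : N%:R `^ e = Y * Y * (Y * Y).
  have nN : (N%:R : R) != 0 by rewrite gt_eqF.
  by rewrite /Y -!powRD ?nN ?implybT //; congr (_ `^ _); field.
have l3 : 0 <= ln (3 : R) by rewrite ln_ge0 // ler1n.
have e8 : 0 < 8 / e by rewrite divr_gt0.
have : (1 + ln 3 + 8 / e) * Y <= Y * Y by rewrite ler_wpM2r ?(ltW Y0).
have : Y * Y <= Y * Y * (Y * Y) by rewrite ler_peMr ?mulr_ge0 ?(ltW Y0) // mulr_ege1.
have : 1 + ln 3 <= (1 + ln 3) * Y by rewrite ler_peMr // addr_ge0.
have -> : 8 / e = 2 * (4 / e) by field; rewrite gt_eqF.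
move: lnN; rewrite [ln _ *+ 2]mulr2n; set a := 4 / e; lra.
Unshelve. all: by end_near. Qed.

End Asymptotics.

(** * Uniformity in the length *)

Section Uniform.
Local Open Scope classical_set_scope.
Variable R : realType.
Implicit Types (g f : nat -> R).

Definition selberg_saving g (G theta : R) :=
  forall h : nat -> nat, (forall N : nat, (0 < h N)%N) ->
    asymp (fun N => (h N)%:R) (fun N => N%:R `^ theta) ->
    vinogradov (fun N => Jwprime g N (h N))
               (fun N => N%:R * (h N)%:R `^ (2%:R - G)).

Lemma Jwprime_ge0 g N h : 0 <= Jwprime g N h.
Proof. by apply: sumr_ge0 => x _; rewrite exprn_ge0. Qed.

(* A bound for each sequence h is uniform in h: otherwise follow a sequence of
   counterexamples. *)
Lemma selberg_saving_uniform g (G theta sigma : R) :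
  0 < G -> 0 < theta -> 0 < sigma -> sigma < theta * G ->
  selberg_saving g G theta ->
  \forall N \near \oo, forall h : nat, (0 < h)%N ->
    N%:R `^ theta <= 2 * h%:R -> h%:R <= 2 * N%:R `^ theta ->
    Jwprime g N h * N%:R `^ sigma <= N%:R * h%:R ^+ 2.
Proof.
move=> G0 th0 s0 sG sav.
pose bad N h := [/\ (0 < h)%N, N%:R `^ theta <= 2 * h%:R, h%:R <= 2 * N%:R `^ theta
   & ~ (Jwprime g N h * N%:R `^ sigma <= N%:R * h%:R ^+ 2)].
have /choice[h hP] : forall N : nat, exists h : nat, (0 < h)%N /\
    ((exists h', bad N h') -> bad N h) /\
    (1 <= N%:R `^ theta -> N%:R `^ theta <= 2 * h%:R :> R /\ h%:R <= 2 * N%:R `^ theta :> R).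
  move=> N; have [[h' b]|nb] := pselect (exists h', bad N h').
    by exists h'; case: (b) => b1 b2 b3 _; split=> //; split=> // _; split.
  (* Where N has no counterexample, any length of order N^theta will do; it only keeps the sequence
     admissible. *)
  exists (Num.truncn (N%:R `^ theta)).+1; split=> //; split=> // N1.
  have /andP[a b] := truncn_itv (powR_ge0 N%:R theta).
  split; first by move: b; lra.
  by rewrite -natr1; move: a; lra.
have h0 N : (0 < h N)%N by case: (hP N).
have hasymp : asymp (fun N => (h N)%:R) (fun N => N%:R `^ theta : R).
  split; apply/vinogradovP; exists 2 => //; near=> N;
  have N1 : 1 <= N%:R `^ theta :> R by near: N; apply: powR_ge_near.
    by case: (hP N) => _ [_ /(_ N1) [a _]]; rewrite !ger0_norm ?powR_ge0.
  by case: (hP N) => _ [_ /(_ N1) [_ a]]; rewrite !ger0_norm ?powR_ge0.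
have /vinogradovP[C C0 HC] := sav h h0 hasymp.
near=> N => k k0 k1 k2; apply: contrapT => nle.
have [_ [/(_ _)hb _]] := hP N.
have [b0 b1 b2 b3] : bad N (h N) by apply: hb; exists k; split.
apply: b3.
have HCN : `|Jwprime g N (h N)| <= C * `|N%:R * (h N)%:R `^ (2%:R - G)|.
  by near: N; exact: HC.
have N1 : 1 <= (N%:R : R) by near: N; apply: nbhs_infty_ger.
have N0 : 0 < (N%:R : R) by rewrite (lt_le_trans ltr01).
have X0 : 0 < ((h N)%:R : R) by rewrite ltr0n.
set X : R := (h N)%:R in b1 b2 HCN X0 *.
move: HCN; rewrite ger0_norm ?Jwprime_ge0 // ger0_norm ?mulr_ge0 ?powR_ge0 // => HCN.
have XE : X `^ (2%:R - G) = X ^+ 2 / X `^ G.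
  rewrite powRB; first by rewrite -[2%:R]/(2%N%:R) powR_mulrn ?(ltW X0).
  by rewrite (gt_eqF X0) implybT.
have XG : N%:R `^ (theta * G) <= 2 `^ G * X `^ G.
  rewrite powRrM -powRM ?(ltW X0) //.
  by rewrite ge0_ler_powR ?nnegrE ?powR_ge0 ?mulr_ge0 ?(ltW X0) ?(ltW G0).
have P0 : 0 < X `^ G by rewrite powR_gt0.
have big : C * 2 `^ G <= N%:R `^ (theta * G - sigma).
  by near: N; apply: powR_ge_near; rewrite subr_gt0.
have CX : C * N%:R `^ sigma <= X `^ G.
  have G2 : 0 < (2 : R) `^ G by rewrite powR_gt0.
  rewrite -(ler_pM2l G2); apply: le_trans XG.
  have -> : theta * G = (theta * G - sigma) + sigma by ring.
  rewrite powRD; last by rewrite (gt_eqF N0) implybT.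
  by rewrite mulrCA mulrA ler_wpM2r ?powR_ge0.
apply: le_trans (ler_wpM2r (powR_ge0 _ _) HCN) _.
rewrite XE.
have -> : C * (N%:R * (X ^+ 2 / X `^ G)) * N%:R `^ sigma =
   N%:R * X ^+ 2 * (C * N%:R `^ sigma / X `^ G) by ring.
rewrite ler_piMr ?mulr_ge0 ?exprn_ge0 ?(ltW X0) //.
by rewrite ler_pdivrMr // mul1r.
Unshelve. all: by end_near. Qed.

(** Descending from [vartheta + tau] in steps of at most [tau], the first grid point not above x is
    taken. The minimum with [vartheta] keeps all exponents inside the range of the hypothesis. *)
Lemma grid_exists (x N theta1 vartheta tau : R) n : 1 <= N -> 0 <= tau ->
  theta1 <= vartheta -> vartheta <= theta1 + n%:R * tau ->
  N `^ theta1 <= x -> x <= N `^ (vartheta + tau) ->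
  exists2 i : 'I_n.+1, N `^ (Num.min vartheta (theta1 + i%:R * tau)) <= x &
     x <= N `^ (Num.min vartheta (theta1 + i%:R * tau) + tau).
Proof.
move=> N1 t0 tv vn x1.
have step j : (j <= n)%N -> x <= N `^ (Num.min vartheta (theta1 + j%:R * tau) + tau) ->
    exists2 i : 'I_n.+1, N `^ (Num.min vartheta (theta1 + i%:R * tau)) <= x &
     x <= N `^ (Num.min vartheta (theta1 + i%:R * tau) + tau).
  elim: j => [|j IH] jn xj.
    by exists ord0 => //; rewrite mul0r addr0 min_r.
  have [h|h] := leP (N `^ (Num.min vartheta (theta1 + j.+1%:R * tau))) x.
    by exists (Ordinal (jn : (j.+1 < n.+1)%N)).
  apply: (IH (ltnW jn)); rewrite (le_trans (ltW h)) // ler_powR //.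
  rewrite -natr1 mulrDl mul1r addrA.
  have [a|a] := leP vartheta (theta1 + j%:R * tau); first by rewrite ge_min lerDl t0.
  by rewrite ge_min lexx orbT.
by move=> xv; apply: (step n) => //; rewrite min_l.
Qed.

(** Finitely many grid exponents need only finitely many thresholds for N, and every length is
    within N^tau of a grid point. The range goes beyond [vartheta] so that implied constants in the
    size of H/m are covered. *)
Lemma total_energy_uniform g (G theta1 vartheta tau : R) :
  ess_bounded g -> 0 < G -> 0 < tau -> 0 < theta1 -> theta1 <= vartheta ->
  40 * tau < theta1 * G -> 40 * tau <= theta1 -> vartheta + 41 * tau <= 1 ->
  (forall theta, theta1 <= theta -> theta <= vartheta -> selberg_saving g G theta) ->
  \forall N \near \oo, forall h : nat,
    N%:R `^ theta1 <= h%:R -> h%:R <= N%:R `^ (vartheta + tau) ->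
    total_energy g N h * (N%:R `^ tau) ^+ 15 <= h%:R * (N%:R * h%:R ^+ 2).
Proof.
move=> gb G0 tau0 th0 thv tG tth tv sav.
set n := (Num.truncn ((vartheta - theta1) / tau)).+1.
have vn : vartheta <= theta1 + n%:R * tau.
  by rewrite -lerBlDl -ler_pdivrMr // ltW // truncnS_gt.
pose th (i : 'I_n.+1) := Num.min vartheta (theta1 + i%:R * tau).
have th1 i : theta1 <= th i.
  by rewrite le_min thv lerDl mulr_ge0 // ltW.
have unif : \forall N \near \oo, forall i : 'I_n.+1, forall h : nat, (0 < h)%N ->
    N%:R `^ (th i) <= 2 * h%:R -> h%:R <= 2 * N%:R `^ (th i) ->
    Jwprime g N h * N%:R `^ (40 * tau) <= N%:R * h%:R ^+ 2.
  apply: filter_forall => i; apply: (@selberg_saving_uniform g G) => //.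
  - by rewrite (lt_le_trans th0).
  - by rewrite mulr_gt0.
  - by rewrite (lt_le_trans tG) // ler_wpM2r // ltW.
  - by apply: sav => //; rewrite ge_min lexx.
near=> N => h h1 h2.
have N1 : 1 <= (N%:R : R) by near: N; apply: nbhs_infty_ger.
have N0 : 0 < (N%:R : R) by rewrite (lt_le_trans ltr01).
have Nn : (N%:R : R) != 0 by rewrite gt_eqF.
set T := N%:R `^ tau.
have T100 : 100 <= T by rewrite /T; near: N; apply: powR_ge_near.
have T0 : 0 < T by rewrite (lt_le_trans _ T100).
have TX m : T ^+ m = N%:R `^ (m%:R * tau).
  by rewrite /T -powR_mulrn ?powR_ge0 // -powRrM mulrC.
have gT : forall n, (0 < n <= 4 * N)%N -> `|g n| <= T.
  by rewrite /T; near: N; apply: ess_bounded_near.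
have th2 : 2 <= N%:R `^ theta1 by near: N; apply: powR_ge_near.
have [i i1 i2] := grid_exists N1 (ltW tau0) thv vn h1 h2.
rewrite -/(th i) in i1 i2.
set Y := N%:R `^ (th i) in i1 *.
have Y2 : 2 <= Y by rewrite (le_trans th2) // ler_powR.
have Y0 : 0 < Y by rewrite (lt_le_trans _ Y2).
have hYT : h%:R <= Y * T by rewrite -powRD ?Nn ?implybT.
(* Then k <= N^tau, and h/k agrees with N^theta up to a factor 2, as the uniform form of the
   hypothesis requires. *)
set k := Num.truncn (h%:R / Y).
have /andP[k1 k2] : k%:R <= h%:R / Y < k.+1%:R.
  by apply: truncn_itv; rewrite divr_ge0 // ltW.
have k0 : (0 < k)%N by rewrite truncn_gt0 ler_pdivlMr // mul1r.
have kT : k%:R <= T.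
  by rewrite (le_trans k1) // ler_pdivrMr // mulrC.
move: k1 k2; rewrite ler_pdivlMr // ltr_pdivrMr // => k1 k2.
have kR : 1 <= (k%:R : R) by rewrite ler1n.
have d1 : k%:R * (h %/ k)%:R <= h%:R :> R by rewrite -natrM ler_nat mulnC leq_trunc_div.
have d2 : h%:R < k%:R * ((h %/ k)%:R + 1) :> R.
  by rewrite natr1 -natrM ltr_nat mulnC ltn_ceil.
have q1 : Y <= 2 * (h %/ k)%:R.
  have : Y < (h %/ k)%:R + 1.
    by rewrite -(ltr_pM2l (lt_le_trans ltr01 kR)) (le_lt_trans k1).
  by move: Y2; lra.
have q2 : (h %/ k)%:R <= 2 * Y.
  rewrite -(ler_pM2l (lt_le_trans ltr01 kR)) (le_trans d1) // (le_trans (ltW k2)) //.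
  rewrite -natr1 mulrA ler_wpM2r ?(ltW Y0) //; move: kR; lra.
have hk0 : (0 < h %/ k)%N by rewrite -(ltr0n R); move: q1 Y0; lra.
apply: (@interp_bound R g N h k T) => //.
- rewrite TX; have unifN : forall i : 'I_n.+1, forall h : nat, (0 < h)%N ->
    N%:R `^ (th i) <= 2 * h%:R -> h%:R <= 2 * N%:R `^ (th i) ->
    Jwprime g N h * N%:R `^ (40 * tau) <= N%:R * h%:R ^+ 2.
    by near: N; exact: unif.
  exact: (unifN i).
- rewrite TX (le_trans (ler_wpM2r (powR_ge0 _ _) h2)) // -powRD ?Nn ?implybT //.
  by rewrite -[leRHS]powRr1 ?(ltW N0) // ler_powR //; lra.
- by rewrite TX (le_trans _ h1) // ler_powR.
Unshelve. all: by end_near. Qed.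

End Uniform.

(** * Choice of the exponents *)

Section Exponents.
Variables (R : realType) (v G : R).
Hypotheses (v_gt : 1 / 3%:R < v) (v_lt : v < 1) (G_gt0 : 0 < G).

(** Here [th1] is the midpoint of the gap between the lower end of the hypothesis and (3v-1)/(1+v),
    [kap] measures how far D stays below (NH)^(1/2), chosen to make the last bound an equality, and
    [tau] is small against everything else. *)
Lemma exponents_exist : exists th1 kap tau : R,
  [/\ (3%:R * v - 1) / ((1 - G) * v + G + 1) < th1, th1 <= v,
      0 < th1, 0 < tau & 100 * tau <= th1 * G] /\
  [/\ 100 * tau <= kap, 100 * tau <= 1 - v, kap <= (3 * v - 1) / 4
     & 2 * kap <= v - th1 - (1 - th1) * ((1 - v) / 2)].
Proof.
have v3 : 0 < 3 * v - 1 by move: v_gt; rewrite ltr_pdivrMr //; lra.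
set den := (1 - G) * v + G + 1.
have den1 : 1 + v < den.
  have : 0 < G * (1 - v) by rewrite mulr_gt0 // subr_gt0.
  by rewrite /den; lra.
have v0 : 0 < 1 + v by lra.
have den0 : 0 < den by lra.
set th0 := (3%:R * v - 1) / den; set a := (3 * v - 1) / (1 + v).
have th00 : 0 < th0 by rewrite divr_gt0.
have th0a : th0 < a by rewrite ltr_pM2l // ltf_pV2 ?posrE.
(* This amounts to (1 - v)^2 >= 0. *)
have av : a <= v.
  rewrite ler_pdivrMr //; have := sqr_ge0 (1 - v); rewrite sqrrB expr1n mul1r.
  by rewrite mulrDr mulr1 -expr2 mulr2n; lra.
set th1 := (th0 + a) / 2.
have t1 : th0 < th1 by rewrite /th1; lra.
have t2 : th1 < a by rewrite /th1; lra.
have t0 : 0 < th1 by lra.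
have t3 : th1 * (1 + v) < 3 * v - 1 by rewrite -ltr_pdivlMr.
have qE : v - th1 - (1 - th1) * ((1 - v) / 2) = (3 * v - 1 - th1 * (1 + v)) / 2 by field.
set kap := (3 * v - 1 - th1 * (1 + v)) / 4.
have kap0 : 0 < kap by rewrite /kap; lra.
set tau := Num.min kap (Num.min (1 - v) (th1 * G)) / 100.
have tE : 100 * tau = Num.min kap (Num.min (1 - v) (th1 * G)) by rewrite /tau; field.
have tG : 0 < th1 * G by rewrite mulr_gt0.
exists th1, kap, tau; split; split; rewrite ?tE ?ge_min ?lexx ?orbT //.
- by lra.
- have : 0 < Num.min kap (Num.min (1 - v) (th1 * G)).
    by rewrite !lt_min kap0 tG subr_gt0 v_lt.
  by move: tE; lra.
- have : 0 < th1 * (1 + v) by rewrite mulr_gt0.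
  by rewrite /kap; lra.
- by rewrite qE /kap; lra.
Qed.

End Exponents.

Section Modulus.
Variable R : realType.

Lemma total_energy_ge0 (g : nat -> R) N h : 0 <= total_energy g N h.
Proof. by apply: sumr_ge0 => t _; apply: shift_energy_ge0. Qed.

Lemma natr_div_bounds (a m : nat) : (0 < m)%N ->
  (a %/ m)%:R <= a%:R / m%:R :> R /\ a%:R / m%:R < (a %/ m)%:R + 1 :> R.
Proof.
move=> m0; have mR : 0 < (m%:R : R) by rewrite ltr0n.
rewrite ler_pdivlMr // ltr_pdivrMr // natr1 -!natrM ler_nat ltr_nat.
by rewrite leq_trunc_div ltn_ceil.
Qed.

(* Dividing N and H by m <= N^(mu + tau) stays in the range of exponents in
   which g is controlled: (v - mu)/(1 - mu) > th1. *)
Lemma modulus_range (n X m v th1 mu tau c : R) :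
  1 <= n -> 1 <= m -> 0 < th1 -> th1 < 1 -> 0 < v -> v < 1 -> 0 < tau -> 0 < c ->
  m <= n `^ (mu + tau) -> n `^ v <= n `^ tau * X -> X <= c * n `^ v ->
  2 <= n `^ tau -> mu + 4 * tau <= 1 / 2 ->
  th1 + mu * (1 - th1) + 4 * tau <= v ->
  [/\ n `^ (1 / 2) <= n / m, 2 * (n / m) `^ th1 <= X / m & X / m <= c * (n / m) `^ v].
Proof.
move=> n1 m1 t0 t1 v0 v1 tau0 c0 mm X1 X2 T2 mu1 muv.
have n0 : 0 < n by rewrite (lt_le_trans ltr01).
have m0 : 0 < m by rewrite (lt_le_trans ltr01).
have nn : n != 0 by rewrite gt_eqF.
have nD a b : n `^ (a + b) = n `^ a * n `^ b by rewrite powRD ?nn ?implybT.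
set y := n / m.
have y0 : 0 < y by rewrite divr_gt0.
have yl : n `^ (1 - mu - tau) <= y.
  rewrite ler_pdivlMr // (le_trans (ler_wpM2l (powR_ge0 _ _) mm)) // -nD.
  by rewrite -[leRHS]powRr1 ?(ltW n0) // ler_powR //; lra.
split.
- by rewrite (le_trans _ yl) // ler_powR //; lra.
- rewrite ler_pdivlMr //.
  (* In this form the lower bound for y = n/m is all that is needed. *)
  have yE : y `^ th1 * m = n / y `^ (1 - th1).
    have -> : n = y * m by rewrite /y divfK // gt_eqF.
    have y1 : y = y `^ th1 * y `^ (1 - th1).
      rewrite -powRD; last by rewrite (gt_eqF y0) implybT.
      by rewrite (_ : th1 + (1 - th1) = 1) ?powRr1 ?(ltW y0) //; ring.
    rewrite {2}y1; field; rewrite gt_eqF // powR_gt0 //.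
  have yb : n `^ ((1 - mu - tau) * (1 - th1)) <= y `^ (1 - th1).
    by rewrite powRrM ge0_ler_powR ?nnegrE ?powR_ge0 ?(ltW y0) // subr_ge0 ltW.
  have yp : 0 < y `^ (1 - th1) by rewrite powR_gt0.
  have Tp : 0 < n `^ tau by rewrite powR_gt0.
  rewrite -mulrA yE -(ler_pM2l Tp); apply: le_trans X1.
  rewrite !mulrA ler_pdivrMr //.
  have e : n `^ tau * n `^ tau * n <= n `^ v * n `^ ((1 - mu - tau) * (1 - th1)).
    rewrite -{3}[n]powRr1 ?(ltW n0) // -!nD ler_powR //.
    have : tau * (1 - th1) <= tau by rewrite ler_piMr ?(ltW tau0) //; lra.
    by move: muv; lra.
  apply: le_trans (_ : _ <= n `^ v * n `^ ((1 - mu - tau) * (1 - th1))) _.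
    apply: le_trans e; rewrite ler_wpM2r ?(ltW n0) // ler_wpM2l ?(ltW Tp) //.
  by rewrite ler_wpM2l ?powR_ge0.
- rewrite ler_pdivrMr // (le_trans X2) // -mulrA ler_wpM2l ?(ltW c0) //.
  have -> : n = y * m by rewrite /y divfK // gt_eqF.
  rewrite powRM ?(ltW y0) ?(ltW m0) // ler_wpM2l ?powR_ge0 //.
  by rewrite -[leRHS]powRr1 ?(ltW m0) // ler_powR // ltW.
Qed.

End Modulus.

(** * Assembly at the chosen exponents *)

Section Assembly.
Local Open Scope classical_set_scope.
Variable R : realType.

Lemma Jwprime_dirichlet_one_near (g : nat -> R) (H : nat -> nat)
    (v G th1 kap tau : R) :
  ess_bounded g -> (forall N, (0 < H N)%N) ->
  asymp (fun N => (H N)%:R) (fun N => N%:R `^ v) ->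
  0 < v -> v < 1 -> 0 < G -> G < 1 -> 0 < th1 -> th1 <= v -> 0 < tau ->
  100 * tau <= th1 * G -> 100 * tau <= kap -> 100 * tau <= 1 - v ->
  kap <= (3 * v - 1) / 4 ->
  2 * kap <= v - th1 - (1 - th1) * ((1 - v) / 2) ->
  (forall theta, th1 <= theta -> theta <= v -> selberg_saving g G theta) ->
  \forall N \near \oo, Jwprime (dirichlet_one g) N (H N) * (N%:R `^ tau) ^+ 3 <=
    12 * (N%:R * (H N)%:R ^+ 2).
Proof.
move=> gb H0 [/vinogradovP[c1 c10 Hc1] /vinogradovP[c2 c20 Hc2]] v0 v1 G0 G1 t0 tv
  tau0 tauG tauk tauv kv kq sav.
have thG : th1 * G <= th1 by rewrite ler_piMr // ltW.
(* The threshold [n0] is made explicit because the bound is applied at the heights N/m, not at N. *)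
have [n0 _ Hn0] : \forall N \near \oo, 2 * c2 <= N%:R `^ tau /\ forall h : nat,
    N%:R `^ th1 <= h%:R -> h%:R <= N%:R `^ (v + tau) ->
    total_energy g N h * (N%:R `^ tau) ^+ 15 <= h%:R * (N%:R * h%:R ^+ 2).
  near=> N; split; first by near: N; apply: powR_ge_near.
  by near: N; apply: (total_energy_uniform gb G0) => //; lra.
(* The exponent of N/D, which bounds the cofactors. *)
pose mu := (1 - v) / 2 + kap.
have th11 : th1 < 1 := le_lt_trans tv v1.
have mu1 : mu + 4 * tau <= 1 / 2 by rewrite /mu; lra.
have mu2 : th1 + mu * (1 - th1) + 4 * tau <= v.
  have : (1 - th1) * kap <= kap by rewrite ler_piMl //; lra.
  by rewrite /mu; lra.
have eD : (1 + v) / 2 - kap <= 1 by lra.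
have eH : 21 * tau <= v by lra.
have eN : 21 * tau + v <= 1 by lra.
have eM : 22 * tau + mu <= v by rewrite /mu; lra.
have eDD : ((1 + v) / 2 - kap) * 2 + 21 * tau <= 1 + v by lra.
near=> N.
have N1 : 1 <= (N%:R : R) by near: N; apply: nbhs_infty_ger.
have N0 : 0 < (N%:R : R) by rewrite (lt_le_trans ltr01).
have Nn : (N%:R : R) != 0 by rewrite gt_eqF.
have nD (a b : R) : N%:R `^ (a + b) = N%:R `^ a * N%:R `^ b by rewrite powRD ?Nn ?implybT.
have T2000 : 2000 <= N%:R `^ tau by near: N; apply: powR_ge_near.
have Tc1 : c1 <= N%:R `^ tau by near: N; apply: powR_ge_near.
have Tc2 : c2 <= N%:R `^ tau by near: N; apply: powR_ge_near.
have gT : forall n, (0 < n <= 4 * N)%N -> `|g n| <= N%:R `^ tau.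
  by near: N; apply: ess_bounded_near.
have hmT : harmonic_sum R (3 * N ^ 2) <= N%:R `^ tau by near: N; apply: harmonic_sum_near.
have n0N : n0%:R <= N%:R `^ (1 / 3) :> R by near: N; apply: powR_ge_near; lra.
have N6 : 2 <= N%:R `^ (1 / 6) :> R by near: N; apply: powR_ge_near; lra.
have N3 : 1 <= N%:R `^ (1 / 3) :> R by near: N; apply: powR_ge_near; lra.
have X1 : N%:R `^ v <= N%:R `^ tau * (H N)%:R.
  have : `|N%:R `^ v| <= c1 * `|(H N)%:R| by near: N; exact: Hc1.
  rewrite !ger0_norm ?powR_ge0 // => /le_trans; apply.
  by rewrite ler_wpM2r.
have X2 : (H N)%:R <= c2 * N%:R `^ v.
  have : `|(H N)%:R| <= c2 * `|N%:R `^ v| by near: N; exact: Hc2.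
  by rewrite !ger0_norm ?powR_ge0.
set n : R := N%:R in N1 N0 Nn nD T2000 Tc1 Tc2 gT hmT n0N N6 N3 X1 X2 *.
set T := n `^ tau in T2000 Tc1 Tc2 gT hmT X1 *.
set X : R := (H N)%:R in X1 X2 *.
have T0 : 0 < T by rewrite powR_gt0.
have TX m : T ^+ m = n `^ (m%:R * tau).
  by rewrite /T -powR_mulrn ?powR_ge0 // -powRrM mulrC.
have X2T : X <= T * n `^ v by rewrite (le_trans X2) // ler_wpM2r ?powR_ge0.
(* In exponents this is (NH)^(1/2) lowered by [kap]. *)
set D := Num.truncn (n `^ ((1 + v) / 2 - kap)).
have /andP[D1 D2] : D%:R <= n `^ ((1 + v) / 2 - kap) < D.+1%:R.
  by apply: truncn_itv; rewrite powR_ge0.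
set M := (3 * N %/ D.+1)%N.
have ND : (D <= N)%N.
  rewrite -(ler_nat R) (le_trans D1) // -[leRHS]powRr1 ?(ltW N0) // ler_powR //.
have M3 : (M <= 3 * N)%N by exact: leq_div.
have N11 : (0 < N)%N by rewrite -(ltr0n R).
have N2 : (N <= N ^ 2)%N by rewrite expnS expn1 leq_pmulr.
have MT : M%:R <= T * n `^ mu.
  have Dp : 0 < (D.+1%:R : R) by [].
  have : M%:R * D.+1%:R <= 3 * n by rewrite -!natrM ler_nat leq_trunc_div.
  rewrite -ler_pdivlMr // => /le_trans; apply.
  rewrite ler_pdivrMr //.
  apply: (@le_trans _ _ (T * n `^ mu * n `^ ((1 + v) / 2 - kap))); last first.
    by rewrite ler_wpM2l ?mulr_ge0 ?powR_ge0 ?(ltW D2).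
  rewrite -mulrA -nD (_ : mu + _ = 1); last by rewrite /mu; field.
  rewrite powRr1 ?(ltW N0) //; apply: (ler_wpM2r (ltW N0)).
  by apply: le_trans T2000; rewrite ler_nat.
apply: (@final_finite R g N (H N) D M T) => //.
- exact: ltn_ceil.
- by apply: le_trans hmT; apply: harmonic_sum_le; rewrite (leq_trans M3) // leq_mul2l N2.
- by apply: le_trans hmT; apply: harmonic_sum_le; rewrite (leq_trans ND) // (leq_trans N2) // leq_pmull.
- apply: le_trans hmT; apply: harmonic_sum_le; rewrite (@leq_trans (N ^ 2)) ?leq_pmull //.
  by rewrite leq_exp2r.
- rewrite -/X -(ler_pM2l T0) -exprS (le_trans _ X1) // TX ler_powR //.
- rewrite -/X (le_trans (ler_wpM2r _ X2T)) ?exprn_ge0 ?(ltW T0) //.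
  rewrite mulrAC -exprS TX -nD -[leRHS]powRr1 ?(ltW N0) // ler_powR //.
- rewrite -/X -(ler_pM2l T0) (le_trans _ X1) //.
  rewrite (le_trans (ler_wpM2l (ltW T0) (ler_wpM2r _ MT))) ?exprn_ge0 ?(ltW T0) //.
  rewrite [leLHS](_ : _ = T ^+ 22 * n `^ mu); last by ring.
  by rewrite TX -nD ler_powR //.
- rewrite -/X -/n -(ler_pM2l T0).
  have D2' : (D ^ 2)%:R <= (n `^ ((1 + v) / 2 - kap)) ^+ 2.
    by rewrite natrX lerXn2r ?nnegrE ?powR_ge0.
  rewrite [leRHS]mulrCA (le_trans _ (ler_wpM2l (ltW N0) X1)) //.
  rewrite [leLHS](_ : _ = (D ^ 2)%:R * T ^+ 21); last by ring.
  rewrite (le_trans (ler_wpM2r _ D2')) ?exprn_ge0 ?(ltW T0) //.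
  rewrite TX -powR_mulrn ?powR_ge0 // -powRrM -nD -{2}[n]powRr1 ?(ltW N0) // -nD.
  by rewrite ler_powR //.
move=> m /andP[m0 mM].
have m1 : 1 <= (m%:R : R) by rewrite ler1n.
have mR : 0 < (m%:R : R) by rewrite ltr0n.
have mT : m%:R <= n `^ (mu + tau).
  by rewrite nD mulrC (le_trans _ MT) // ler_nat.
have T2 : 2 <= n `^ tau by apply: le_trans T2000; rewrite ler_nat.
have [y1 y2 y3] := modulus_range N1 m1 t0 th11 v0 v1 tau0 c20 mT X1 X2 T2 mu1 mu2.
have [Na Nb] := @natr_div_bounds R N m m0.
have [Ha Hb] := @natr_div_bounds R (H N) m m0.
rewrite -/n in Na Nb; rewrite -/X in Ha Hb.
(* The factor N^(1/6) >= 2 absorbs the rounding of N/m, leaving N/m >= N^(1/3) uniformly in m. *)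
have NE : n `^ (1 / 2) = n `^ (1 / 3) * n `^ (1 / 6).
  by rewrite -nD; congr (_ `^ _); field.
have N3' : n `^ (1 / 3) <= (N %/ m)%:R.
  have : n `^ (1 / 3) * 2 <= n `^ (1 / 2) by rewrite NE ler_wpM2l ?powR_ge0.
  by clear -y1 Nb N3; lra.
have nN' : (n0 <= N %/ m)%N by rewrite -(ler_nat R) (le_trans n0N).
have [k1 k2] := Hn0 _ nN'.
set N' : R := (N %/ m)%:R in Na Nb N3' k1 k2 *.
set h : R := (H N %/ m)%:R in Ha Hb *.
have N'1 : 1 <= N' by rewrite (le_trans N3).
have N'0 : 0 < N' by rewrite (lt_le_trans ltr01).
have hl : N' `^ th1 <= h.
  have a1 : N' `^ th1 <= (n / m%:R) `^ th1.
    by rewrite ge0_ler_powR ?nnegrE ?(ltW t0) ?(ltW N'0) // divr_ge0 ?(ltW N0).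
  have a2 : 1 <= N' `^ th1 by rewrite -(powRr0 N') ler_powR // ltW.
  by clear -y2 Hb a1 a2; lra.
(* The spare exponent [tau] absorbs the constant [c2] and the factor 2 from rounding N/m. *)
have hu : h <= N' `^ (v + tau).
  have a1 : (n / m%:R) `^ v <= (2 * N') `^ v.
    rewrite ge0_ler_powR ?nnegrE ?(ltW v0) ?divr_ge0 ?(ltW N0) ?mulr_ge0 ?(ltW N'0) //.
    by clear -Nb N'1; lra.
  have a2 : (2 * N') `^ v <= 2 * N' `^ v.
    rewrite powRM ?(ltW N'0) // ler_wpM2r ?powR_ge0 //.
    by rewrite -[leRHS]powRr1 // ler_powR ?(ltW v1) // ler1n.
  rewrite powRD ?(gt_eqF N'0) ?implybT //.
  apply: (@le_trans _ _ (N' `^ v * (2 * c2))); last by rewrite ler_wpM2l ?powR_ge0.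
  rewrite [leRHS](_ : _ = c2 * (2 * N' `^ v)); last by ring.
  apply: le_trans (le_trans Ha y3) _.
  exact: (ler_wpM2l (ltW c20) (le_trans a1 a2)).
have h0 : (0 < H N %/ m)%N.
  rewrite -(ltr0n R) (lt_le_trans _ hl) // powR_gt0 //.
split=> //; apply: le_trans (k2 _ hl hu).
rewrite ler_wpM2l ?total_energy_ge0 //.
(* Since N/m >= N^(1/3), the saving (N/m)^(15 tau) is at least T^5; this is why 15 was aimed at. *)
have TN : T <= (N' `^ tau) ^+ 3.
  rewrite -powR_mulrn ?powR_ge0 // -powRrM.
  have -> : T = (n `^ (1 / 3)) `^ (tau * 3).
    by rewrite /T -powRrM; congr (_ `^ _); field.
  by rewrite ge0_ler_powR ?nnegrE ?powR_ge0 ?mulr_ge0 ?(ltW tau0) ?(ltW N'0).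
rewrite -[15%N]/(3 * 5)%N exprM lerXn2r ?nnegrE ?exprn_ge0 ?powR_ge0 ?(ltW T0) //.
Unshelve. all: by end_near. Qed.

End Assembly.

Theorem theorem2 (R : realType) (vartheta G : R)
    (vartheta_gt : 1 / 3%:R < vartheta) (vartheta_lt : vartheta < 1)
    (G_gt0 : 0 < G) (G_lt1 : G < 1) :
  exists2 G' : R, 0 < G' &
    forall (g : nat -> R) (H : nat -> nat),
      ess_bounded g ->
      (forall N : nat, (0 < H N)%N) ->
      asymp (fun N => (H N)%:R) (fun N => N%:R `^ vartheta) ->
      (forall theta : R,
         (3%:R * vartheta - 1) / ((1 - G) * vartheta + G + 1) < theta ->
         theta <= vartheta ->
         forall h : nat -> nat,
           (forall N : nat, (0 < h N)%N) ->
           asymp (fun N => (h N)%:R) (fun N => N%:R `^ theta) ->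
           vinogradov (fun N => Jwprime g N (h N))
                      (fun N => N%:R * (h N)%:R `^ (2%:R - G))) ->
      vinogradov (fun N => Jwprime (dirichlet_one g) N (H N))
                 (fun N => N%:R * (H N)%:R `^ (2%:R - 3%:R * G')).
Proof.
have [th1 [kap [tau [[t1 t2 t3 t4 t5] [k1 k2 k3 k4]]]]] :=
  exponents_exist vartheta_gt vartheta_lt G_gt0.
have v0 : 0 < vartheta by rewrite (lt_le_trans t3).
exists tau => // g H gb H0 Hv sav.
have main := @Jwprime_dirichlet_one_near R g H vartheta G th1 kap tau gb H0 Hv v0
  vartheta_lt G_gt0 G_lt1 t3 t2 t4 t5 k1 k2 k3 k4
  (fun theta a b => sav theta (lt_le_trans t1 a) b).
case: Hv => _ /vinogradovP[c c0 Hc].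
apply/vinogradovP; exists (12 * c `^ (3 * tau)).
  by rewrite mulr_gt0 // powR_gt0.
near=> N.
have N1 : 1 <= (N%:R : R) by near: N; apply: nbhs_infty_ger.
have N0 : 0 < (N%:R : R) by rewrite (lt_le_trans ltr01).
have : Jwprime (dirichlet_one g) N (H N) * (N%:R `^ tau) ^+ 3 <=
    12 * (N%:R * (H N)%:R ^+ 2) by near: N; exact: main.
have : `|(H N)%:R| <= c * `|N%:R `^ vartheta : R| by near: N; exact: Hc.
have X0 : 0 < ((H N)%:R : R) by rewrite ltr0n.
rewrite !ger0_norm ?powR_ge0 ?Jwprime_ge0 ?mulr_ge0 ?powR_ge0 //.
move: X0; set X : R := (H N)%:R; set n : R := N%:R in N0 N1 *; set J := Jwprime _ _ _.
move=> X0 Xc Jb.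
(* A saving in powers of N is one in powers of H, because H is at most a constant times N. *)
have XT : X `^ (3 * tau) <= c `^ (3 * tau) * (n `^ tau) ^+ 3.
  have a : X <= c * n.
    rewrite (le_trans Xc) // ler_wpM2l ?(ltW c0) //.
    by rewrite -[leRHS]powRr1 ?(ltW N0) // ler_powR // ltW.
  have -> : (n `^ tau) ^+ 3 = n `^ (3 * tau).
    by rewrite -powR_mulrn ?powR_ge0 // -powRrM mulrC.
  rewrite -powRM ?(ltW c0) ?(ltW N0) //.
  by rewrite ge0_ler_powR ?nnegrE ?mulr_ge0 ?(ltW t4) ?(ltW X0) ?(ltW c0) ?(ltW N0).
have XE : X `^ (2%:R - 3%:R * tau) = X ^+ 2 / X `^ (3 * tau).
  rewrite powRB; first by rewrite -[2%:R]/(2%N%:R) powR_mulrn ?(ltW X0).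
  by rewrite (gt_eqF X0) implybT.
have Xp : 0 < X `^ (3 * tau) by rewrite powR_gt0.
rewrite XE mulrA mulrA ler_pdivlMr //.
have J0 : 0 <= J by apply: Jwprime_ge0.
apply: le_trans (ler_wpM2l J0 XT) _.
rewrite [leLHS](_ : _ = c `^ (3 * tau) * (J * (n `^ tau) ^+ 3)); last by ring.
rewrite [leRHS](_ : _ = c `^ (3 * tau) * (12 * (n * X ^+ 2))); last by ring.
by rewrite ler_wpM2l ?powR_ge0.
Unshelve. all: by end_near. Qed.
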